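(* For any seed $\mathbf s_t$, $t\in\mathfrak T$, let $v=\sum_{i\in I\setminus I_{\mathrm{uf}}}a_i\,\mathbf e_{i;t}$ for some $a_i\in\mathbb Z_{\ge0}$, and suppose $\{\mathbf e_{j;t},v\}\ge0$ for each $j\in I_{\mathrm{uf}}$. Then $z^v\in\Bbbk_q[N]$ (viewed as an element of the quantum torus algebra of the seed $\mathbf s_t$) remains a polynomial in the quantum cluster variables for any seed in the mutation class.
   Context: **Seeds.** Let $N$ be a lattice of rank $n$ with a skew-symmetric form $\{\cdot,\cdot\}:N\times N\to\mathbb Q$; $I$ an index set with $|I|=n$, $I_{\mathrm{uf}}\subset I$ the unfrozen indices; $d_i$ ($i\in I$) positive integers with gcd $1$. The initial seed $\mathbf s_0=(\mathbf e_i)_{i\in I}$ is a $\mathbb Z$-basis of $N$ such that $\varepsilon_{ij}:=d_i\{\mathbf e_i,\mathbf e_j\}\in\mathbb Z$ whenever $i$ or $j$ lies in $I_{\mathrm{uf}}$. Write $[a]_+=\max(0,a)$. For $k\in I_{\mathrm{uf}}$ the mutated seed $\mu_k(\mathbf s)$ has $\mathbf e_i'=\mathbf e_i+[\varepsilon_{ki}]_+\mathbf e_k$ for $i\ne k$ and $\mathbf e_k'=-\mathbf e_k$. $\mathfrak T$ is the infinite rooted tree with root $t_0$ and one outgoing edge for each $k\in I_{\mathrm{uf}}$ at each vertex; each $t\in\mathfrak T$ carries the seed $\mathbf s_t=(\mathbf e_{i;t})$ obtained from $\mathbf s_{t_0}=\mathbf s_0$ by the corresponding mutations. **Quantum cluster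 algebra.** Let $\Bbbk$ be a field of characteristic $0$, $q$ a formal parameter, $d$ a positive integer divisible by all $d_i$ with $\{N,N\}\subset\frac1d\mathbb Z$, $\Bbbk_q=\Bbbk[q^{\pm1/d}]$, $q_k=q^{1/d_k}$. $\Bbbk_q[N]$ is the $\Bbbk_q$-algebra with basis $z^n$ ($n\in N$) and $q^{\{n_1,n_2\}}z^{n_1}z^{n_2}=z^{n_1+n_2}$. The pullback $\mu_k^*$ on skew fields of fractions, from the seed $\mu_k(\mathbf s)$ to the seed $\mathbf s$, is conjugation by $\Psi_{q_k}(z^{\mathbf e_k})$ with $\Psi_q(x)=\prod_{r\ge1}(1+q^{2r-1}x)^{-1}$; explicitly, with $c=-d_k\{\mathbf e_k,n\}$, $\mu_k^*(z^n)=z^n\prod_{r=1}^{c}(1+q_k^{2r-1}z^{\mathbf e_k})$ if $c\ge0$, and $\mu_k^*(z^n)=z^n\prod_{r=1}^{|c|}(1+q_k^{-(2r-1)}z^{\mathbf e_k})^{-1}$ if $c<0$. $\mu_t^*$ denotes the composite pullback from $\mathbf s_t$ to $\mathbf s_{t_0}$. The quantum cluster variables of $\mathbf s_t$ are $X_{i;t}=z^{\mathbf e_{i;t}}$, $i\in I$. An element $h$ of the quantum torus algebra of $\mathbf s_t$ is a polynomial in the quantum cluster variables for the seed $\mathbf s_{t'}$ if $\mu_t^*(h)=\mu_{t'}^*(h')$ with $h'$ a $\Bbbk_q$-linear combination of elements $z^n$, $n\in\bigoplus_i\mathbb Z_{\ge0}\mathbf e_{i;t'}$. *)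

(* Defs.v *)
From HB Require Import structures.
From mathcomp Require Import all_boot all_order all_algebra.
From mathcomp Require Import archimedean finmap.
From mathcomp Require Import monalg.

Set Implicit Arguments.
Unset Strict Implicit.
Unset Printing Implicit Defensive.

Import Order.TTheory GRing.Theory Num.Theory.
Local Open Scope ring_scope.

(* Twisted group algebras: finitely supported functions G -> R with basis     *)
(* elements << g >> multiplied by << g >> * << h >> = sigma g h << g + h >>.  *)
(* (The ring structure that monalg puts on {malg R[G]} needs a monomType,     *)
(* whose only unit is 1, hence does not apply to a group.)                    *)

Record cocycle (R : comNzRingType) (G : zmodType) := Cocycle {
  cocycle_fun :> G -> G -> R;
  cocycle0l : forall g, cocycle_fun 0 g = 1;
  cocycle0r : forall g, cocycle_fun g 0 = 1;
  cocycleA : forall g h l,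
    cocycle_fun h l * cocycle_fun g (h + l) =
    cocycle_fun g h * cocycle_fun (g + h) l
}.

Definition twisted_galg (R : comNzRingType) (G : zmodType)
  (sigma : cocycle R G) : Type := {malg R[G]}.

Section TwistedGroupAlgebra.
Variables (R : comNzRingType) (G : zmodType) (sigma : cocycle R G).

Local Notation A := (twisted_galg sigma).
Implicit Types (x y : {malg R[G]}).

HB.instance Definition _ := GRing.Lmodule.copy A {malg R[G]}.

Definition tone : A := << 0 >>.

Definition tmul (x y : A) : A :=
  \sum_(g <- msupp x) \sum_(h <- msupp y)
    << x@_g * y@_h * sigma g h *g g + h >>.

Lemma tmulw (d1 d2 : {fset G}) x y :
  (msupp x `<=` d1)%fset -> (msupp y `<=` d2)%fset ->
  tmul x y = \sum_(g <- d1) \sum_(h <- d2)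
               << x@_g * y@_h * sigma g h *g g + h >>.
Proof.
move=> le1 le2; rewrite /tmul (big_fset_incl _ le1) /=.
  apply/eq_bigr => g _; apply/big_fset_incl => // h _ /mcoeff_outdom ->.
  by rewrite mulr0 mul0r monalgU0.
move=> g _ /mcoeff_outdom xg.
by rewrite big1 // => h _; rewrite xg !mul0r monalgU0.
Qed.

Lemma tmulDl : left_distributive tmul +%R.
Proof.
move=> x y z.
rewrite (tmulw (msuppD_le x y) (fsubset_refl (msupp z))).
rewrite (tmulw (fsubsetUl (msupp x) (msupp y)) (fsubset_refl (msupp z))).
rewrite (tmulw (fsubsetUr (msupp x) (msupp y)) (fsubset_refl (msupp z))).
rewrite -big_split /=; apply/eq_bigr => g _.
rewrite -big_split /=; apply/eq_bigr => h _.
by rewrite mcoeffD !mulrDl monalgUD.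
Qed.

Lemma tmulDr : right_distributive tmul +%R.
Proof.
move=> z x y.
rewrite (tmulw (fsubset_refl (msupp z)) (msuppD_le x y)).
rewrite (tmulw (fsubset_refl (msupp z)) (fsubsetUl (msupp x) (msupp y))).
rewrite (tmulw (fsubset_refl (msupp z)) (fsubsetUr (msupp x) (msupp y))).
rewrite -big_split /=; apply/eq_bigr => g _.
rewrite -big_split /=; apply/eq_bigr => h _.
by rewrite mcoeffD mulrDr mulrDl monalgUD.
Qed.

Lemma tmul0 : left_zero 0 tmul.
Proof. by move=> x; rewrite /tmul msupp0 big_seq_fset0. Qed.

Lemma tmulr0 : right_zero 0 tmul.
Proof.
by move=> x; rewrite /tmul msupp0 big1 // => g _; rewrite big_seq_fset0.
Qed.

Lemma tmulUU (a b : R) (g h : G) :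
  tmul << a *g g >> << b *g h >> = << a * b * sigma g h *g g + h >>.
Proof. by rewrite (tmulw msuppU_le msuppU_le) !big_seq_fset1 !mcoeffUU. Qed.

Lemma tmulE x y :
  tmul x y = \sum_(g <- msupp x) \sum_(h <- msupp y)
               tmul << x@_g *g g >> << y@_h *g h >>.
Proof.
by apply/eq_bigr => g _; apply/eq_bigr => h _; rewrite tmulUU.
Qed.

Lemma tmul_suml (I : Type) (r : seq I) (F : I -> A) (y : A) :
  tmul (\sum_(i <- r) F i) y = \sum_(i <- r) tmul (F i) y.
Proof. exact: (big_morph (tmul^~ y) (fun u v => tmulDl u v y) (tmul0 y)). Qed.

Lemma tmul_sumr (I : Type) (r : seq I) (F : I -> A) (x : A) :
  tmul x (\sum_(i <- r) F i) = \sum_(i <- r) tmul x (F i).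
Proof. exact: (big_morph (tmul x) (fun u v => tmulDr x u v) (tmulr0 x)). Qed.

Lemma tmulA : associative tmul.
Proof.
move=> x y z.
rewrite [in LHS](monalgE x) [in RHS](monalgE x).
rewrite (tmul_suml _ _ (tmul y z)) (tmul_suml _ _ y) (tmul_suml _ _ z).
apply: eq_bigr => g _; set xg := << x@_g *g g >>.
rewrite [in LHS](monalgE y) [in RHS](monalgE y).
rewrite (tmul_suml _ _ z) !(tmul_sumr _ _ xg) (tmul_suml _ _ z).
apply: eq_bigr => h _; set yh := << y@_h *g h >>.
rewrite [in LHS](monalgE z) [in RHS](monalgE z).
rewrite (tmul_sumr _ _ yh) (tmul_sumr _ _ xg) (tmul_sumr _ _ (tmul xg yh)).
apply: eq_bigr => l _; rewrite /xg /yh !tmulUU addrA.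
congr (<< _ *g _ >>).
by rewrite -!mulrA cocycleA (mulrCA (z@_l)).
Qed.

Lemma tmul1 : left_id tone tmul.
Proof.
move=> x; rewrite (tmulw msuppU_le (fsubset_refl (msupp x))) big_seq_fset1.
rewrite [RHS]monalgE; apply/eq_bigr => g _.
by rewrite mcoeffUU mul1r cocycle0l mulr1 add0r.
Qed.

Lemma tmulr1 : right_id tone tmul.
Proof.
move=> x; rewrite (tmulw (fsubset_refl (msupp x)) msuppU_le).
rewrite [RHS]monalgE; apply/eq_bigr => g _; rewrite big_seq_fset1.
by rewrite mcoeffUU mulr1 cocycle0r mulr1 addr0.
Qed.

Lemma tone_neq0 : tone != 0.
Proof. by rewrite monalgU_eq0 oner_eq0. Qed.

HB.instance Definition _ := GRing.Zmodule_isNzRing.Build A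
  tmulA tmul1 tmulr1 tmulDl tmulDr tone_neq0.

Lemma tscale_mull (c : R) (x y : A) : c *: (x * y) = (c *: x) * y.
Proof.
apply/esym; rewrite [LHS](tmulw (msuppZ_le c x) (fsubset_refl (msupp y))).
rewrite scaler_sumr; apply/eq_bigr => g _.
rewrite scaler_sumr; apply/eq_bigr => h _.
by apply/malgP => l; rewrite mcoeffZ !mcoeffZ !mcoeffU -!mulrA mulrnAr.
Qed.

HB.instance Definition _ := GRing.LSemiModule_isLSemiAlgebra.Build R A tscale_mull.

Lemma tscale_mulr (c : R) (x y : A) : c *: (x * y) = x * (c *: y).
Proof.
apply/esym; rewrite [LHS](tmulw (fsubset_refl (msupp x)) (msuppZ_le c y)).
rewrite scaler_sumr; apply/eq_bigr => g _.
rewrite scaler_sumr; apply/eq_bigr => h _.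
apply/malgP => l; rewrite mcoeffZ !mcoeffZ !mcoeffU mulrnAr.
by rewrite [x@_g * _]mulrCA -!mulrA.
Qed.

HB.instance Definition _ :=
  GRing.LSemiAlgebra_isSemiAlgebra.Build R A tscale_mulr.

End TwistedGroupAlgebra.

Section LaurentPolynomials.
Variable K : fieldType.

Definition trivial_cocycle : cocycle K int.
Proof. by exists (fun _ _ => 1) => *; rewrite ?mulr1. Defined.

(* K[x, x^-1], with x = << 1 >>.                                              *)
Definition laurent : Type := twisted_galg trivial_cocycle.

HB.instance Definition _ := GRing.Algebra.on laurent.

Lemma laurent_mulC : commutative (@GRing.mul laurent).
Proof.
move=> x y; rewrite [LHS](_ : _ = tmul x y) // [RHS](_ : _ = tmul y x) //.
rewrite /tmul exchange_big; apply/eq_bigr => g _; apply/eq_bigr => h _.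
by rewrite addrC [x@_h * _]mulrC.
Qed.

HB.instance Definition _ :=
  GRing.PzRing_hasCommutativeMul.Build laurent laurent_mulC.

End LaurentPolynomials.

(* The integer equal to an integral rational number.                          *)
Definition intq (x : rat) : int := Num.floor x.

(* dmul i is d_i, and qden is the integer d with the exponents of q in (1/d)Z. *)
Record seed_data := SeedData {
  lattice : zmodType;
  skewform : lattice -> lattice -> rat;
  formDl : forall u v w, skewform (u + v) w = skewform u w + skewform v w;
  form_skew : forall u v, skewform u v = - skewform v u;
  idx : finType;
  unfrozen : {set idx};
  dmul : idx -> nat;
  dmul_gt0 : forall i, (0 < dmul i)%N;
  dmul_gcd : \big[gcdn/0%N]_i dmul i = 1%N;
  seed0 : idx -> lattice;
  seed0_basis : forall v,
    exists! a : {ffun idx -> int}, v = \sum_i seed0 i *~ a i;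
  seed0_int : forall i j, i \in unfrozen \/ j \in unfrozen ->
    (dmul i)%:R * skewform (seed0 i) (seed0 j) \is a Num.int;
  qden : nat;
  qden_gt0 : (0 < qden)%N;
  dmul_qden : forall i, (dmul i %| qden)%N;
  form_qden : forall u v, qden%:R * skewform u v \is a Num.int
}.

Section QuantumTorus.
Variables (K : fieldType) (D : seed_data).

(* Laurent polynomials over K in the variable q^(1/d), d = qden D.            *)
Definition kq : Type := laurent K.
HB.instance Definition _ := GRing.ComNzRing.on kq.

(* q^r, for r in (1/d)Z.                                                      *)
Definition qpow (r : rat) : kq := << intq ((qden D)%:R * r) >>.

Lemma qpow0 : qpow 0 = 1.
Proof. by rewrite /qpow mulr0 /intq floor0. Qed.

Lemma qpowD (r s : rat) :
  (qden D)%:R * r \is a Num.int -> qpow r * qpow s = qpow (r + s).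
Proof.
move=> rZ; rewrite [LHS](tmulUU (trivial_cocycle K)) /= !mulr1 /qpow mulrDr.
by rewrite /intq floorDzr.
Qed.

Let L := lattice D.
Let sigma (u v : L) : kq := qpow (- skewform u v).

Lemma form0l (v : L) : skewform 0 v = 0.
Proof. by apply: (@addrI _ (skewform 0 v)); rewrite -formDl !addr0. Qed.

Lemma form0r (v : L) : skewform v 0 = 0.
Proof. by rewrite form_skew form0l oppr0. Qed.

Lemma formDr (u v w : L) : skewform u (v + w) = skewform u v + skewform u w.
Proof. by rewrite form_skew formDl opprD -!form_skew. Qed.

Lemma form_qdenN (u v : L) : (qden D)%:R * - skewform u v \is a Num.int.
Proof. by rewrite mulrN rpredN form_qden. Qed.

Definition torus_cocycle : cocycle kq L.
Proof.
exists sigma => [v|v|u v w].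
- by rewrite /sigma form0l oppr0 qpow0.
- by rewrite /sigma form0r oppr0 qpow0.
- rewrite /sigma !qpowD ?form_qdenN // formDl formDr !opprD.
  by congr qpow; rewrite addrC addrA.
Defined.

(* kq[N]: z^u * z^v = q^(- skewform u v) z^(u + v).                           *)
Definition qtorus : Type := twisted_galg torus_cocycle.
HB.instance Definition _ := GRing.Algebra.on qtorus.

Definition zpow (v : L) : qtorus := << v >>.

Lemma zpowM (u v : L) : qpow (skewform u v) *: (zpow u * zpow v) = zpow (u + v).
Proof.
rewrite [zpow u * _](tmulUU torus_cocycle) /= !mul1r.
apply/malgP => w; rewrite mcoeffZ !mcoeffU mulrnAr.
by rewrite [_ * sigma u v]qpowD ?form_qden // subrr qpow0.
Qed.

End QuantumTorus.

Arguments zpow K {D} v.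
Arguments qpow K D r.

(* A skew field of (right) fractions of A: a division ring containing A in    *)
(* which every element is of the form a b^-1 with a, b in A. When it exists   *)
(* (A an Ore domain, as quantum tori are) it is unique up to a unique         *)
(* isomorphism over A.                                                        *)
Record skew_fractions (A : nzRingType) := SkewFractions {
  skew_sort :> unitRingType;
  skew_inj : {rmorphism A -> skew_sort};
  skew_injP : injective skew_inj;
  skew_unit : forall x : skew_sort, x != 0 -> x \is a GRing.unit;
  skew_frac : forall x : skew_sort, exists ab : A * A,
    (ab.2 != 0) && (x == skew_inj ab.1 / skew_inj ab.2)
}.

Definition fraction_of (A : nzRingType) (F : skew_fractions A) (x : F) : A * A :=
  xchoose (skew_frac x).

Section Mutation.
Variable D : seed_data.

Definition seed : Type := idx D -> lattice D.

Definition eps (s : seed) (i j : idx D) : rat :=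
  (dmul i)%:R * skewform (s i) (s j).

Definition mutate (s : seed) (k : idx D) : seed := fun i =>
  if i == k then - s k else s i + s k *~ Num.max 0 (intq (eps s k i)).

(* A vertex of the rooted tree is the word of labels of the edges leading to  *)
(* it from the root.                                                          *)
Definition tree : Type := seq {k : idx D | k \in unfrozen D}.

Fixpoint mutate_along (s : seed) (w : tree) : seed :=
  if w is k :: w' then mutate_along (mutate s (val k)) w' else s.

Definition seed_at (t : tree) : seed := mutate_along (@seed0 D) t.

Variables (K : fieldType) (F : skew_fractions (qtorus K D)).

Local Notation z := (@zpow K D).

(* q_k^m, where q_k = q^(1/d_k).                                              *)
Definition qk (k : idx D) (m : rat) : kq K := qpow K D (m / (dmul k)%:R).

(* 1 + q_k^m z^(e_k)                                                          *)
Definition mut_factor (s : seed) (k : idx D) (m : rat) : qtorus K D :=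
  1 + qk k m *: z (s k).

(* Conjugation of z^n by the quantum dilogarithm of z^(e_k), in closed form.  *)
Definition mut_monomial (s : seed) (k : idx D) (n : lattice D) : F :=
  let c := intq (- ((dmul k)%:R * skewform (s k) n)) in
  if 0 <= c then
    skew_inj F (z n) *
      \prod_(1 <= r < `|c|%N.+1) skew_inj F (mut_factor s k (2 * r%:R - 1))
  else
    skew_inj F (z n) *
      \prod_(1 <= r < `|c|%N.+1)
        (skew_inj F (mut_factor s k (- (2 * r%:R - 1))))^-1.

(* The kq-linear extension of mut_monomial.                                   *)
Definition mut_torus (s : seed) (k : idx D) (h : qtorus K D) : F :=
  mmap (fun c : kq K => skew_inj F (c *: 1)) (mut_monomial s k) h.

(* mu_k^*, from the seed mutate s k to the seed s, extended to fractions.     *)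
Definition mut_pullback (s : seed) (k : idx D) (x : F) : F :=
  let ab := fraction_of x in mut_torus s k ab.1 / mut_torus s k ab.2.

Fixpoint pullback_along (s : seed) (w : tree) (x : F) : F :=
  if w is k :: w' then
    mut_pullback s (val k) (pullback_along (mutate s (val k)) w' x)
  else x.

(* mu_t^*, from the seed at t to the initial seed.                            *)
Definition pullback (t : tree) : F -> F := pullback_along (@seed0 D) t.

Definition in_cone (s : seed) (n : lattice D) : Prop :=
  exists a : idx D -> nat, n = \sum_i s i *+ a i.

Definition cluster_polynomial (s : seed) (h : qtorus K D) : Prop :=
  exists (r : seq (lattice D)) (c : lattice D -> kq K),
    (forall n, n \in r -> in_cone s n) /\ h = \sum_(n <- r) c n *: z n.

(* h, in the quantum torus of the seed at t, is a polynomial in the quantum   *)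
(* cluster variables of the seed at t'.                                       *)
Definition polynomial_in (t : tree) (h : qtorus K D) (t' : tree) : Prop :=
  exists2 h' : qtorus K D, cluster_polynomial (seed_at t') h' &
    pullback t (skew_inj F h) = pullback t' (skew_inj F h').

End Mutation.

(* Main.v *)
(* Psi(z^e_k) is given a meaning in a bimodule of all functions on the lattice,*)
(* so that mu_k^* g = h becomes the fraction-free relation h Psi = Psi g.      *)
(*                                                                            *)
(* Laurentness: suppose h remains a Laurent polynomial under the mutations at  *)
(* k and l. Choosing the sign of the tropical part of the mutation at k so     *)
(* that e_l is unchanged, z^(e_k) (or its inverse) is itself Laurent after the *)
(* mutation at l; hence so is the series Psi(z^e_k), and conjugation by it     *)
(* preserves Laurentness at l. So being Laurent in a seed and all its          *)
(* neighbours is invariant under mutation, and z^v has this property since     *)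
(* {e_j, v} >= 0.                                                              *)
(*                                                                            *)
(* Nonnegativity of the exponents of z^v along e_j at t': adjoin to N an       *)
(* element alpha with {n, alpha} = e_j^*(n), the coordinate at t'. By the same *)
(* argument z^alpha, a monomial at t', is Laurent at t. For i frozen, the      *)
(* sign of {e_i, .} on exponents is invariant under mutation, so the exponents *)
(* m of z^alpha at t satisfy {v, m} >= 0: the weights of z^alpha under         *)
(* conjugation by z^v are q^(-2 {v, m}), and a product of the corresponding    *)
(* q-commutators with z^v kills it. Computed at t', the lowest term along      *)
(* e_j^* of this vanishing expression forces the lowest exponent r of z^v to   *)
(* satisfy q^(-2 r) = q^(-2 {v, m}) for some m, whence r >= 0.                 *)

Require Import Defs.
From mathcomp Require Import all_boot all_order all_algebra.
From mathcomp Require Import archimedean finmap boolp.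
From mathcomp Require Import monalg ring zify.
Import Defs.

Set Implicit Arguments.
Unset Strict Implicit.
Unset Printing Implicit Defensive.

Import Order.TTheory GRing.Theory Num.Theory.
Local Open Scope ring_scope.

(** Laurentness. Call h expandable along e if h Psi(z^e) = Psi(z^e) g for some Laurent polynomial g,
    that is, if h stays Laurent after the mutation in direction e. A monomial z^n with {e, n} >= 0
    is expandable ([expandable_mono]), so z^v lies in [upper_bound] at t. The crux is
    [expandable_conj]: if {f, e} >= 0, then z^e is expandable along f, so conjugation by Psi(z^e)
    preserves expandability along f. The denominators of the coefficients of Psi are removed by
    [expandable_sat]. The opposite sign is reduced to this one by [conj_flip], which replaces e by
    -e at the price of the isometry [shear]. Hence [upper_bound] is invariant under mutation
    ([upper_bound_mutate]), and z^v has Laurent expansions h0 at the root and h at t' ([corresp_up],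
    [corresp_down]).

    Nonnegative exponents. For a coordinate [l] at t', [extension] adjoins a frozen alpha with {n,
    alpha} = l(n). By the first half z^alpha, taken at t', has a Laurent expansion B at t, and
    [corresp_weight] gives {v, p} >= 0 for every exponent p of B ([weights_ge0]). A product of
    q-commutators with z^v having weights q^(-2 {v, p}) kills B. Read at t' in lowest degree along
    [l], this relation forces the lowest degree of h to be one of the {v, p} ([reciprocity]).

    Finally [pullback_corresp] identifies these fraction-free relations with the pullbacks in the
    skew field. *)

(** * Bilinearity of the skew form and integrality of exponents of q *)

Section Form.
Variable D : seed_data.
Local Notation L := (lattice D).
Local Notation form := (@skewform D).

(** Only for such r is [qpow] a genuine power q^r; other exponents are rounded by the floor in its
    definition. *)
Definition qint (r : rat) : Prop := (qden D)%:R * r \is a Num.int.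

Lemma qintD r s : qint r -> qint s -> qint (r + s).
Proof. by rewrite /qint mulrDr; apply: rpredD. Qed.

Lemma qintN r : qint r -> qint (- r).
Proof. by rewrite /qint mulrN rpredN. Qed.

Lemma qint_form u v : qint (form u v).
Proof. exact: form_qden. Qed.

Lemma formNl (u v : L) : form (- u) v = - form u v.
Proof. by apply: (@addrI _ (form u v)); rewrite -formDl !subrr form0l. Qed.

Lemma formNr (u v : L) : form u (- v) = - form u v.
Proof. by rewrite form_skew formNl -form_skew. Qed.

Lemma formBr (u v w : L) : form u (v - w) = form u v - form u w.
Proof. by rewrite formDr formNr. Qed.

Lemma formBl (u v w : L) : form (u - v) w = form u w - form v w.
Proof. by rewrite formDl formNl. Qed.

Lemma formxx (u : L) : form u u = 0.
Proof. by apply/eqP; rewrite -eqNr -form_skew. Qed.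

Lemma formMnl (u v : L) m : form (u *+ m) v = m%:R * form u v.
Proof.
elim: m => [|m IH]; first by rewrite mulr0n form0l mul0r.
by rewrite mulrS formDl IH -add1n natrD mulrDl mul1r.
Qed.

Lemma formMnr (u v : L) m : form u (v *+ m) = m%:R * form u v.
Proof. by rewrite form_skew formMnl -mulrN -form_skew. Qed.

Lemma formMzl (u v : L) (m : int) : form (u *~ m) v = m%:~R * form u v.
Proof.
case: m => m; first by rewrite -!pmulrn formMnl.
by rewrite NegzE !mulrNz formNl -pmulrn formMnl mulNr -pmulrn.
Qed.

Lemma formMzr (u v : L) (m : int) : form u (v *~ m) = m%:~R * form u v.
Proof. by rewrite form_skew formMzl -mulrN -form_skew. Qed.

Lemma form_suml (I : Type) (r : seq I) (P : pred I) (f : I -> L) v :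
  form (\sum_(i <- r | P i) f i) v = \sum_(i <- r | P i) form (f i) v.
Proof.
exact: (big_morph (fun u => form u v) (fun u w => formDl u w v) (form0l v)).
Qed.

Lemma form_sumr (I : Type) (r : seq I) (P : pred I) (f : I -> L) v :
  form v (\sum_(i <- r | P i) f i) = \sum_(i <- r | P i) form v (f i).
Proof.
exact: (big_morph (form v) (fun u w => formDr v u w) (form0r v)).
Qed.

End Form.
Arguments qint D r : clear implicits.

(** * The quantum torus and its completed bimodule *)

(* An interface to [qtorus K D] that keeps unification from unfolding the     *)
(* product of the twisted algebra.                                            *)
Record torus (R : comNzRingType) (D : seed_data) := Torus {
  talg :> algType R;
  mono : lattice D -> talg;
  coef : talg -> lattice D -> R;
  supp : talg -> seq (lattice D);
  qp : rat -> R;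
  qp0 : qp 0 = 1;
  qpM : forall r s, qint D r -> qp r * qp s = qp (r + s);
  qp_neq1 : forall r, qint D r -> qp r = 1 -> r = 0;
  torusP : forall x y, (forall n, coef x n = coef y n) -> x = y;
  mem_supp : forall x n, (n \in supp x) = (coef x n != 0);
  supp_uniq : forall x, uniq (supp x);
  coefD : forall x y n, coef (x + y) n = coef x n + coef y n;
  coefZ : forall c x n, coef (c *: x) n = c * coef x n;
  coef_mono : forall m n, coef (mono m) n = (m == n)%:R;
  mono0 : mono 0 = 1;
  monoM : forall m n, mono m * mono n = qp (- skewform m n) *: mono (m + n)
}.

Definition qtor (K : fieldType) (D : seed_data) : torus (kq K) D.
Proof.
exists (qtorus K D) (@zpow K D)
  (fun x n => (x : {malg (kq K)[lattice D]})@_n)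
  (fun x => msupp (x : {malg (kq K)[lattice D]})) (qpow K D).
- exact: qpow0.
- exact: qpowD.
- move=> r rZ /(congr1 (fun x : kq K => (x : {malg K[int]})@_0)) E.
  have := mcoeffU (intq ((qden D)%:R * r)) (1 : K) 0.
  rewrite [LHS]E [LHS](mcoeffU (0 : int) (1 : K) 0) eqxx.
  case: eqP => [E0 _|_ /eqP]; last by rewrite oner_eq0.
  move: (floorK rZ); rewrite -/(intq _) E0 => /esym/eqP; rewrite mulf_eq0 pnatr_eq0.
  by rewrite eqn0Ngt qden_gt0 => /eqP.
- by move=> x y /malgP.
- by move=> x n; rewrite mcoeff_neq0.
- by move=> x; exact: fset_uniq.
- by move=> x y n; exact: mcoeffD.
- by move=> c x n; exact: mcoeffZ.
- by move=> m n; exact: (mcoeffU m 1 n).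
- by [].
- move=> m n; rewrite -zpowM scalerA qpowD ?addNr ?qpow0 ?scale1r //.
  exact/qintN/qint_form.
Defined.

Section TorusTheory.
Variables (R : comNzRingType) (D : seed_data) (X : torus R D).
Local Notation L := (lattice D).
Local Notation form := (@skewform D).
Local Notation z := (@mono R D X).
Implicit Types (x y : X) (m n : L).

Lemma coef0 n : coef (0 : X) n = 0.
Proof. by have := coefZ 0 (0 : X) n; rewrite scale0r mul0r. Qed.

Lemma coef_sum (I : Type) (r : seq I) (P : pred I) (f : I -> X) n :
  coef (\sum_(i <- r | P i) f i) n = \sum_(i <- r | P i) coef (f i) n.
Proof.
exact: (big_morph (fun x => coef x n) (fun x y => coefD x y n) (coef0 n)).
Qed.

Lemma supp_nil x n : n \notin supp x -> coef x n = 0.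
Proof. by rewrite mem_supp negbK => /eqP. Qed.

Lemma torus_neq0 x : x != 0 -> exists n, n \in supp x.
Proof.
move=> x0; case E: (supp x) => [|n s]; last by exists n; rewrite mem_head.
case/eqP: x0; apply: torusP => n.
by rewrite coef0 supp_nil // E.
Qed.

Lemma big_supp (V : nmodType) (f : L -> V) x (s : seq L) :
  uniq s -> {subset supp x <= s} -> (forall n, coef x n = 0 -> f n = 0) ->
  \sum_(n <- s) f n = \sum_(n <- supp x) f n.
Proof.
move=> us xs f0; rewrite (bigID (mem (supp x))) /= addrC big1 => [|n nx].
  rewrite add0r -big_filter; apply: perm_big; apply: uniq_perm.
  - exact: filter_uniq.
  - exact: supp_uniq.
  move=> n; rewrite mem_filter /=.
  by case nx: (n \in supp x) => //=; rewrite xs.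
by apply: f0; apply: supp_nil.
Qed.

Lemma torus_sum x : x = \sum_(n <- supp x) coef x n *: z n.
Proof.
apply: torusP => n; rewrite coef_sum.
under eq_bigr => m _ do rewrite coefZ coef_mono.
case nx: (n \in supp x).
  rewrite (bigD1_seq n) ?supp_uniq //= eqxx mulr1 big1 ?addr0 // => m.
  by move=> /negbTE ->; rewrite mulr0.
rewrite supp_nil ?nx // big_seq big1 // => m mx; case: eqP => [E|_].
  by rewrite -E mx in nx.
by rewrite mulr0.
Qed.

Lemma torus_ind (P : X -> Prop) :
  P 0 -> (forall x y, P x -> P y -> P (x + y)) ->
  (forall c n, P (c *: z n)) -> forall x, P x.
Proof.
move=> P0 PD Pz x; rewrite [x]torus_sum; elim: (supp x) => [|n s IH].
  by rewrite big_nil.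
by rewrite big_cons; apply: PD.
Qed.

Lemma coef_monoMl m x n : coef (z m * x) n = qp X (- form m n) * coef x (n - m).
Proof.
elim/torus_ind: x => [|x y IHx IHy|c p].
- by rewrite mulr0 !coef0 mulr0.
- by rewrite mulrDr !coefD IHx IHy mulrDr.
rewrite -scalerAr monoM !coefZ !coef_mono mulrCA (can2_eq (addKr m) (addNKr m)).
rewrite [- m + n]addrC; case: eqP => [->|_]; last by rewrite !mulr0.
by rewrite formBr formxx subr0.
Qed.

Lemma coef_monoMr m x n : coef (x * z m) n = qp X (form m n) * coef x (n - m).
Proof.
elim/torus_ind: x => [|x y IHx IHy|c p].
- by rewrite mul0r !coef0 mulr0.
- by rewrite mulrDl !coefD IHx IHy mulrDr.
rewrite -scalerAl monoM !coefZ !coef_mono mulrCA (can2_eq (addrK m) (subrK m)).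
case: eqP => [->|_]; last by rewrite !mulr0.
by rewrite formBl formxx subr0 -form_skew.
Qed.

Lemma qpMN r : qint D r -> qp X r * qp X (- r) = 1.
Proof. by move=> rZ; rewrite qpM // subrr qp0. Qed.

Lemma qp_unit r c : qint D r -> qp X r * c = 0 -> c = 0.
Proof.
move=> rZ /(congr1 ( *%R (qp X (- r)))).
by rewrite mulrA [qp X (- r) * _]mulrC qpMN // mul1r mulr0.
Qed.

Lemma mono_comm m n : z m * z n = qp X (- (form m n *+ 2)) *: (z n * z m).
Proof.
rewrite !monoM scalerA qpM ?mulr2n; last first.
  by apply: qintN; apply: qintD; exact: qint_form.
by rewrite [form n m]form_skew opprK opprD addrNK addrC.
Qed.

(* Functions L -> S form a bimodule over the torus: the completed version of  *)
(* the regular bimodule.                                                      *)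
Variables (S : unitRingType) (iota : {rmorphism R -> S}).
Implicit Types (f g : L -> S).

(** The twists come from z^m z^(n-m) = q^(-{m,n}) z^n and z^(n-m) z^m = q^({m,n}) z^n. Scalars
    multiply from the left in both actions, because the image of [iota] need not be central in S. *)
Definition lact x f n : S :=
  \sum_(m <- supp x) iota (coef x m * qp X (- form m n)) * f (n - m).
Definition ract f x n : S :=
  \sum_(m <- supp x) iota (coef x m * qp X (form m n)) * f (n - m).

Lemma lactE (w : seq L) x f n : uniq w -> {subset supp x <= w} ->
  lact x f n = \sum_(m <- w) iota (coef x m * qp X (- form m n)) * f (n - m).
Proof.
by move=> uw xw; rewrite (big_supp uw xw) // => m ->; rewrite mul0r rmorph0 mul0r.
Qed.

Lemma ractE (w : seq L) x f n : uniq w -> {subset supp x <= w} ->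
  ract f x n = \sum_(m <- w) iota (coef x m * qp X (form m n)) * f (n - m).
Proof.
by move=> uw xw; rewrite (big_supp uw xw) // => m ->; rewrite mul0r rmorph0 mul0r.
Qed.

Lemma supp_common (s : seq X) : exists2 w : seq L, uniq w &
  forall x, x \in s -> {subset supp x <= w}.
Proof.
exists (undup (flatten (map (@supp R D X) s))); first exact: undup_uniq.
move=> x xs n nx; rewrite mem_undup; apply/flattenP; exists (supp x) => //.
exact: map_f.
Qed.

Local Ltac common sw := try by apply: sw; rewrite !inE eqxx ?orbT.

Lemma lactD x y f n : lact (x + y) f n = lact x f n + lact y f n.
Proof.
have [w uw sw] := supp_common [:: x; y; x + y].
rewrite !(@lactE w) //; common sw; rewrite -big_split /=.
by apply: eq_bigr => m _; rewrite coefD mulrDl rmorphD mulrDl.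
Qed.

Lemma ractD x y f n : ract f (x + y) n = ract f x n + ract f y n.
Proof.
have [w uw sw] := supp_common [:: x; y; x + y].
rewrite !(@ractE w) //; common sw; rewrite -big_split /=.
by apply: eq_bigr => m _; rewrite coefD mulrDl rmorphD mulrDl.
Qed.

Lemma lactZ c x f n : lact (c *: x) f n = iota c * lact x f n.
Proof.
have [w uw sw] := supp_common [:: x; c *: x].
rewrite !(@lactE w) //; common sw; rewrite mulr_sumr /=.
by apply: eq_bigr => m _; rewrite coefZ -mulrA rmorphM mulrA.
Qed.

Lemma ractZ c x f n : ract f (c *: x) n = iota c * ract f x n.
Proof.
have [w uw sw] := supp_common [:: x; c *: x].
rewrite !(@ractE w) //; common sw; rewrite mulr_sumr /=.
by apply: eq_bigr => m _; rewrite coefZ -mulrA rmorphM mulrA.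
Qed.

Lemma supp_mono m : {subset supp (z m) <= [:: m]}.
Proof.
by move=> n; rewrite mem_supp coef_mono mem_seq1 [m == n]eq_sym; case: (n == m); rewrite ?eqxx.
Qed.

Lemma lact_mono m f n : lact (z m) f n = iota (qp X (- form m n)) * f (n - m).
Proof. by rewrite (@lactE [:: m]) //; [rewrite big_seq1 coef_mono eqxx mul1r | exact: supp_mono]. Qed.

Lemma ract_mono m f n : ract f (z m) n = iota (qp X (form m n)) * f (n - m).
Proof. by rewrite (@ractE [:: m]) //; [rewrite big_seq1 coef_mono eqxx mul1r | exact: supp_mono]. Qed.

Lemma lact0 f n : lact 0 f n = 0.
Proof. by rewrite -(scale0r 0) lactZ rmorph0 mul0r. Qed.

Lemma ract0 f n : ract f 0 n = 0.
Proof. by rewrite -(scale0r 0) ractZ rmorph0 mul0r. Qed.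

Lemma lactDr x f g : lact x (fun n => f n + g n) = fun n => lact x f n + lact x g n.
Proof.
apply/funext => n; rewrite -big_split; apply: eq_bigr => m _.
by rewrite mulrDr.
Qed.

Lemma ractDr x f g : ract (fun n => f n + g n) x = fun n => ract f x n + ract g x n.
Proof.
apply/funext => n; rewrite -big_split; apply: eq_bigr => m _.
by rewrite mulrDr.
Qed.

Lemma iotaC a b (s : S) : iota a * (iota b * s) = iota b * (iota a * s).
Proof. by rewrite !mulrA -!rmorphM mulrC. Qed.

Lemma ractZr x c f : ract (fun n => iota c * f n) x = fun n => iota c * ract f x n.
Proof.
apply/funext => n; rewrite mulr_sumr; apply: eq_bigr => m _.
by rewrite iotaC.
Qed.

Lemma lact0r x : lact x (fun=> 0) = fun=> 0.
Proof. by apply/funext => n; rewrite /lact big1 // => m _; rewrite mulr0. Qed.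

Lemma ract0r x : ract (fun=> 0) x = fun=> 0.
Proof. by apply/funext => n; rewrite /ract big1 // => m _; rewrite mulr0. Qed.

Lemma lactM x y f : lact (x * y) f = lact x (lact y f).
Proof.
elim/torus_ind: x => [|x1 x2 IH1 IH2|c m].
- by apply/funext => n; rewrite mul0r !lact0.
- by apply/funext => n; rewrite mulrDl !lactD IH1 IH2.
elim/torus_ind: y => [|y1 y2 IH1 IH2|d p].
- by have /funext -> := lact0 f; rewrite mulr0 lact0r; apply/funext => n; rewrite lact0.
- rewrite mulrDr; apply/funext => n; rewrite lactD IH1 IH2.
  by have /funext -> := lactD y1 y2 f; rewrite lactDr.
apply/funext => n; rewrite -scalerAl -scalerAr monoM !lactZ !lact_mono.
rewrite lactZ lact_mono -addrA -opprD.
congr (_ * _); rewrite [in RHS]iotaC; congr (_ * _).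
rewrite mulrA -rmorphM qpM ?[in RHS]mulrA -?rmorphM ?qpM; last first.
- by do ?apply: qintN; apply: qint_form.
- by do ?apply: qintN; apply: qint_form.
congr (iota (qp X _) * _); rewrite formBr formDl [form p m]form_skew; ring.
Qed.

Lemma ractM x y f : ract f (x * y) = ract (ract f x) y.
Proof.
elim/torus_ind: y => [|y1 y2 IH1 IH2|c m].
- by apply/funext => n; rewrite mulr0 !ract0.
- by apply/funext => n; rewrite mulrDr !ractD IH1 IH2.
elim/torus_ind: x => [|x1 x2 IH1 IH2|d p].
- by have /funext -> := ract0 f; rewrite mul0r ract0r; apply/funext => n; rewrite ract0.
- rewrite mulrDl; apply/funext => n; rewrite ractD IH1 IH2.
  by have /funext -> := ractD x1 x2 f; rewrite ractDr.
apply/funext => n; rewrite -scalerAr -scalerAl monoM !ractZ !ract_mono.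
rewrite ractZ ract_mono -addrA -opprD [m + p]addrC.
congr (_ * _); rewrite [in RHS]iotaC; congr (_ * _).
rewrite mulrA -rmorphM qpM ?[in RHS]mulrA -?rmorphM ?qpM; last first.
- by do ?apply: qintN; apply: qint_form.
- by do ?apply: qintN; apply: qint_form.
congr (iota (qp X _) * _); rewrite formBr formDl [form p m]form_skew; ring.
Qed.

Lemma lractA x y f : ract (lact x f) y = lact x (ract f y).
Proof.
elim/torus_ind: x => [|x1 x2 IH1 IH2|c m].
- have /funext -> := lact0 f; rewrite ract0r.
  by apply/funext => n; rewrite lact0.
- have /funext -> := lactD x1 x2 f; rewrite ractDr IH1 IH2.
  by apply/funext => n; rewrite lactD.
elim/torus_ind: y => [|y1 y2 IH1 IH2|d p].
- by have /funext -> := ract0 f; rewrite lact0r; apply/funext => n; rewrite ract0.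
- have /funext -> := ractD y1 y2 f; rewrite lactDr -IH1 -IH2.
  by apply/funext => n; rewrite ractD.
apply/funext => n; rewrite lactZ ractZ lact_mono ract_mono lactZ ractZ.
rewrite lact_mono ract_mono (iotaC _ c) (iotaC d c); congr (_ * _).
rewrite [in RHS](iotaC _ d); congr (_ * _).
rewrite !mulrA -!rmorphM !qpM; last 2 first.
- by do ?apply: qintN; apply: qint_form.
- by do ?apply: qintN; apply: qint_form.
congr (iota (qp X _) * f _); last by rewrite addrAC.
by rewrite !formBr [form m p]form_skew; ring.
Qed.
End TorusTheory.

(** * Conjugation by the quantum dilogarithm *)

Definition additive_fun (L : zmodType) (V : zmodType) (l : L -> V) : Prop :=
  forall u v, l (u + v) = l u + l v.

Section AdditiveFun.
Variables (L V : zmodType) (l : L -> V) (lD : additive_fun l).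

Lemma addf0 : l 0 = 0.
Proof. by apply: (@addrI _ (l 0)); rewrite -lD !addr0. Qed.

Lemma addfN u : l (- u) = - l u.
Proof. by apply: (@addrI _ (l u)); rewrite -lD !subrr addf0. Qed.

Lemma addfB u v : l (u - v) = l u - l v.
Proof. by rewrite lD addfN. Qed.

Lemma addfMn u m : l (u *+ m) = l u *+ m.
Proof. by elim: m => [|m IH]; rewrite ?mulr0n ?addf0 // !mulrS lD IH. Qed.

Lemma addfMz u m : l (u *~ m) = l u *~ m.
Proof. by case: m => m; rewrite ?NegzE ?mulrNz ?addfN -!pmulrn addfMn. Qed.

End AdditiveFun.

(** What is used of a pair (d_k, e_k). The function of [dir_lam] grades the lattice with e in degree
    1: multiples of e are distinct and power series in z^e have a lowest term. *)
Record direction (D : seed_data) (d : nat) (e : lattice D) : Prop := Direction {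
  dir_gt0 : (0 < d)%N;
  dir_dvd : (d %| qden D)%N;
  dir_int : forall n, d%:R * skewform e n \is a Num.int;
  dir_lam : exists2 l : lattice D -> int, additive_fun l & l e = 1
}.

Definition cexp (D : seed_data) (d : nat) (e n : lattice D) : int :=
  intq (- (d%:R * skewform e n)).

Section Dilogarithm.
Variables (R : comNzRingType) (D : seed_data) (X : torus R D).
Variables (S : unitRingType) (iota : {rmorphism R -> S}).
Hypothesis iota_unit : forall a, a != 0 -> iota a \is a GRing.unit.
Local Notation L := (lattice D).
Local Notation form := (@skewform D).
Local Notation z := (@mono R D X).
Local Notation lact := (@lact R D X S iota).
Local Notation ract := (@ract R D X S iota).
Variables (d : nat) (e : L).
Implicit Types (x y g h : X) (n p : L) (m : nat).

Definition qr (a : rat) : R := qp X (a / d%:R).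

(* The coefficients of Psi_q(x) = \sum_m c_m x^m, determined by               *)
(* Psi_q(q^2 x) = (1 + q x) Psi_q(x).                                         *)
Fixpoint dilog_coef (m : nat) : S :=
  if m is m'.+1 then
    (iota (qr (2 * m%:R) - 1))^-1 * (iota (qr 1) * dilog_coef m')
  else 1.

(* Psi_q(q^(2j) z^e), with q = q_k                                            *)
Definition dilog (j : int) (n : L) : S :=
  if pselect (exists m : nat, n = e *+ m) is left ex_m then
    let m := projT1 (cid ex_m) in
    iota (qr (2 * j%:~R * m%:R)) * dilog_coef m
  else 0.

(* h = Psi(z^e) g Psi(z^e)^-1, that is, h = mu_k^* g when e = e_k.            *)
Definition dilog_conj (g h : X) : Prop := lact h (dilog 0) = ract (dilog 0) g.

Definition dfactor (a : rat) : X := 1 + qr a *: z e.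
Definition dprod_pos (m : nat) : X := \prod_(1 <= r < m.+1) dfactor (2 * r%:R - 1).
Definition dprod_neg (m : nat) : X :=
  \prod_(1 <= r < m.+1) dfactor (- (2 * r%:R - 1)).

Definition proj (P : pred L) x : X := \sum_(n <- supp x | P n) coef x n *: z n.

Lemma coef_proj P x n : coef (proj P x) n = if P n then coef x n else 0.
Proof.
rewrite /proj coef_sum; under eq_bigr => m _ do rewrite coefZ coef_mono.
case nx: (n \in supp x); last first.
  rewrite supp_nil ?nx // if_same big_seq_cond big1 // => m /andP[mx _].
  by case: eqP => [E|_]; rewrite ?mulr0 //; rewrite -E mx in nx.
rewrite big_mkcond (bigD1_seq n) ?supp_uniq //= eqxx mulr1 big1 ?addr0 // => m.
by move=> /negbTE ->; rewrite mulr0 if_same.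
Qed.

Hypothesis de : direction d e.

Lemma dir_d_neq0 : d%:R != 0 :> rat.
Proof. by rewrite pnatr_eq0 -lt0n (dir_gt0 de). Qed.

Lemma qint_div (a : int) : qint D (a%:~R / d%:R).
Proof.
rewrite /qint; have /dvdnP[m ->] := dir_dvd de.
by rewrite natrM mulrCA mulfK ?dir_d_neq0 // rpredM ?intr_int ?natr_int.
Qed.

Lemma qint_divZ (a : rat) : a \is a Num.int -> qint D (a / d%:R).
Proof. by move=> /intrP[i ->]; apply: qint_div. Qed.

Lemma qrM (a b : rat) : a \is a Num.int -> qr a * qr b = qr (a + b).
Proof.
by move=> /intrP[i ->]; rewrite /qr qpM ?mulrDl //; apply: qint_div.
Qed.

Lemma qr0 : qr 0 = 1. Proof. by rewrite /qr mul0r qp0. Qed.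

Lemma cexpE n : (cexp d e n)%:~R = - (d%:R * form e n) :> rat.
Proof. by rewrite /cexp /intq floorK // rpredN (dir_int de). Qed.

Lemma cexp_form n : form e n = - (cexp d e n)%:~R / d%:R.
Proof. by rewrite cexpE opprK mulrAC mulfV ?mul1r ?dir_d_neq0. Qed.

Lemma cexpD : additive_fun (cexp d e).
Proof.
by move=> u v; apply: (@intr_inj rat); rewrite rmorphD /= !cexpE formDr mulrDr opprD.
Qed.

Lemma cexp_self : cexp d e e = 0.
Proof. by apply: (@intr_inj rat); rewrite cexpE formxx mulr0 oppr0. Qed.

Lemma dir_mulrn_inj m1 m2 : e *+ m1 = e *+ m2 -> m1 = m2.
Proof.
have [l lD le] := dir_lam de; move/(congr1 l).
by rewrite !(addfMn lD) le => /eqP; rewrite eqr_nat => /eqP.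
Qed.

Lemma dir_neg m : e *+ m != - e.
Proof.
have [l lD le] := dir_lam de; apply/eqP => /(congr1 l).
by rewrite (addfMn lD) (addfN lD) le; lia.
Qed.

Lemma dilogE j m : dilog j (e *+ m) = iota (qr (2 * j%:~R * m%:R)) * dilog_coef m.
Proof.
rewrite /dilog; case: pselect => [ex_m|[]]; last by exists m.
by case: (cid ex_m) => m' /= /dir_mulrn_inj <-.
Qed.

Lemma dilog_out j n : (forall m : nat, n <> e *+ m) -> dilog j n = 0.
Proof. by move=> out; rewrite /dilog; case: pselect => // -[m E]; case: (out m). Qed.

Lemma dilogP j n : (exists m : nat, n = e *+ m) \/ dilog j n = 0.
Proof.
case: (pselect (exists m : nat, n = e *+ m)) => [|N]; first by left.
by right; apply: dilog_out => m E; apply: N; exists m.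
Qed.

Lemma dilog00 : dilog 0 0 = 1.
Proof. by rewrite -(mulr0n e) dilogE mulr0 qr0 rmorph1 mul1r. Qed.

(** The functional equation of Psi in degree m + 1. The division in [dilog_coef] is legitimate
    because q is not a root of unity ([qp_neq1]). *)
Lemma dilog_coefS m :
  iota (qr (2 * m.+1%:R)) * dilog_coef m.+1 =
  dilog_coef m.+1 + iota (qr 1) * dilog_coef m.
Proof.
have u : iota (qr (2 * m.+1%:R) - 1) \is a GRing.unit.
  apply: iota_unit; rewrite subr_eq0; apply/eqP => E.
  have /qp_neq1/(_ E)/eqP : qint D (2 * m.+1%:R / d%:R).
    by apply: qint_divZ; rewrite rpredM ?natr_int.
  by rewrite mulf_eq0 invr_eq0 (negbTE dir_d_neq0) orbF mulf_eq0 !pnatr_eq0.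
have -> : iota (qr (2 * m.+1%:R)) = iota (qr (2 * m.+1%:R) - 1) + 1.
  by rewrite rmorphB rmorph1 subrK.
by rewrite mulrDl mul1r addrC /= mulVKr.
Qed.

Lemma mono_dilog_commute j : lact (z e) (dilog j) = ract (dilog j) (z e).
Proof.
apply/funext => p; rewrite lact_mono ract_mono.
have [[m E]|->] := dilogP j (p - e); last by rewrite !mulr0.
by move: E => /eqP; rewrite subr_eq => /eqP ->; rewrite formDr formMnr !formxx mulr0.
Qed.

Lemma lact1 f : lact 1 f = f.
Proof. by apply/funext => n; rewrite -mono0 lact_mono form0l oppr0 qp0 rmorph1 mul1r subr0. Qed.

Lemma ract1 f : ract f 1 = f.
Proof. by apply/funext => n; rewrite -mono0 ract_mono form0l qp0 rmorph1 mul1r subr0. Qed.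

Lemma dfactor_commute a j : lact (dfactor a) (dilog j) = ract (dilog j) (dfactor a).
Proof.
apply/funext => p; rewrite lactD ractD lactZ ractZ lact1 ract1.
by rewrite mono_dilog_commute.
Qed.

(** The functional equation Psi(q^2 x) = (1 + q x) Psi(x) at x = q^(2j) z^e, with q = q_k. *)
Lemma dilog_shift j : lact (dfactor (2 * j%:~R + 1)) (dilog j) = dilog (j + 1).
Proof.
apply/funext => p; rewrite lactD lact1 lactZ lact_mono.
case: (pselect (exists m : nat, p = e *+ m)) => [[[|m] ->]|out]; last first.
- have outp j' : dilog j' p = 0 by apply: dilog_out => m E; apply: out; exists m.
  rewrite !outp dilog_out ?mulr0 ?addr0 // => m /eqP; rewrite subr_eq -mulrSr => /eqP E.
  by apply: out; exists m.+1.
- rewrite mulrSr addrK -mulrSr !dilogE formMnr formxx mulr0 oppr0 qp0 rmorph1 mul1r.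
  have E a b : a \is a Num.int -> iota (qr (a + b)) = iota (qr a) * iota (qr b).
    by move=> aZ; rewrite -rmorphM qrM.
  have jZ : 2 * j%:~R * m.+1%:R \is a @Num.int rat.
    by rewrite !rpredM ?intr_int ?natr_int.
  have -> : 2 * (j + 1)%:~R * m.+1%:R = 2 * j%:~R * m.+1%:R + 2 * m.+1%:R :> rat.
    by rewrite intrD; ring.
  rewrite (E _ _ jZ) -[in RHS]mulrA dilog_coefS mulrDr; congr (_ + _).
  rewrite !mulrA -!E ?intr_int //; last first.
    by rewrite rpredD ?rpred1 // rpredM ?intr_int ?natr_int.
  by rewrite -natr1; congr (iota (qr _) * _); ring.
- rewrite mulr0n sub0r -(mulr0n e) !dilogE dilog_out => [|m E]; last first.
    by case/eqP: (dir_neg m).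
  by rewrite !mulr0 addr0.
Qed.

Lemma dfactor_comm a b : GRing.comm (dfactor a) (dfactor b).
Proof.
apply: commrD; first exact: commr1.
apply/commr_sym/commrD; first exact: commr1.
by rewrite /GRing.comm -!scalerAl -!scalerAr !scalerA mulrC.
Qed.

Lemma dprod_posS m : dprod_pos m.+1 = dfactor (2 * m%:R + 1) * dprod_pos m.
Proof.
rewrite /dprod_pos big_nat_recr //=.
have -> : 2 * m.+1%:R - 1 = 2 * m%:R + 1 :> rat by rewrite -natr1; ring.
by apply/commr_sym/commr_prod => i _; apply: dfactor_comm.
Qed.

Lemma dprod_negS m : dprod_neg m.+1 = dprod_neg m * dfactor (- (2 * m%:R + 1)).
Proof.
rewrite /dprod_neg big_nat_recr //=; congr (_ * dfactor (- _)).
by rewrite -natr1; ring.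
Qed.

Lemma dilog_pos m : lact (dprod_pos m) (dilog 0) = dilog m.
Proof.
elim: m => [|m IH]; first by rewrite /dprod_pos big_geq // lact1.
by rewrite dprod_posS lactM IH [m%:R]pmulrn dilog_shift -addn1 PoszD.
Qed.

Lemma dilog_neg m : lact (dprod_neg m) (dilog (- m%:Z)) = dilog 0.
Proof.
elim: m => [|m IH]; first by rewrite /dprod_neg big_geq // lact1.
rewrite dprod_negS lactM -IH; congr lact.
have -> : - (2 * m%:R + 1) = 2 * (- m.+1%:Z)%:~R + 1 :> rat.
  by rewrite intrN -pmulrn -natr1; ring.
by rewrite dilog_shift; congr dilog; lia.
Qed.

Lemma dprod_neg_commute m j : lact (dprod_neg m) (dilog j) = ract (dilog j) (dprod_neg m).
Proof.
elim: m => [|m IH]; first by rewrite /dprod_neg big_geq // lact1 ract1.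
by rewrite dprod_negS lactM dfactor_commute -lractA IH ractM.
Qed.

(** Moving z^n to the left of (z^e)^m costs q_k^(2cm), which rescales the argument of Psi by
    q_k^(2c). *)
Lemma mono_dilog n : ract (dilog 0) (z n) = lact (z n) (dilog (cexp d e n)).
Proof.
apply/funext => p; rewrite ract_mono lact_mono.
have [[m E]|out] := dilogP 0 (p - n); last first.
  rewrite out; case: (pselect (exists m : nat, p - n = e *+ m)) => [[m E]|ex].
    move: out; rewrite E dilogE mulr0 mul0r qr0 rmorph1 mul1r => out.
    by rewrite dilogE out !mulr0.
  by rewrite dilog_out ?mulr0 // => m E; apply: ex; exists m.
rewrite E !dilogE mulr0 mul0r qr0 rmorph1 mul1r mulrA -rmorphM.
have -> : form n p = (cexp d e n)%:~R * m%:R / d%:R.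
  move/eqP: E; rewrite subr_eq => /eqP ->; rewrite formDr formxx addr0 formMnr.
  by rewrite form_skew cexp_form; ring.
congr (iota _ * _); rewrite -mulNr -/(qr _) -/(qr _) qrM ?rpredN ?rpredM ?intr_int ?natr_int //.
by congr qr; ring.
Qed.

Lemma conj_pos n : 0 <= cexp d e n -> dilog_conj (z n) (z n * dprod_pos `|cexp d e n|%N).
Proof. by move=> c0; rewrite /dilog_conj lactM dilog_pos gez0_abs // mono_dilog. Qed.

(** The formula for negative c, with the denominator moved to the source so that both sides stay in
    the torus. *)
Lemma conj_neg n : cexp d e n <= 0 -> dilog_conj (z n * dprod_neg `|cexp d e n|%N) (z n).
Proof.
move=> c0; rewrite /dilog_conj ractM mono_dilog lractA -dprod_neg_commute.
have E : cexp d e n = - (`|cexp d e n|%N%:Z) by lia.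
by rewrite {2}E dilog_neg.
Qed.

Lemma conjD g1 h1 g2 h2 :
  dilog_conj g1 h1 -> dilog_conj g2 h2 -> dilog_conj (g1 + g2) (h1 + h2).
Proof.
rewrite /dilog_conj => E1 E2; apply/funext => n.
by rewrite lactD ractD E1 E2.
Qed.

Lemma conjZ c g h : dilog_conj g h -> dilog_conj (c *: g) (c *: h).
Proof. by rewrite /dilog_conj => E; apply/funext => n; rewrite lactZ ractZ E. Qed.

Lemma conjN g h : dilog_conj g h -> dilog_conj (- g) (- h).
Proof. by rewrite -!scaleN1r; apply: conjZ. Qed.

Lemma conjB g1 h1 g2 h2 :
  dilog_conj g1 h1 -> dilog_conj g2 h2 -> dilog_conj (g1 - g2) (h1 - h2).
Proof. by move=> E1 E2; apply: conjD => //; apply: conjN. Qed.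

Lemma conj0 : dilog_conj 0 0.
Proof. by apply/funext => n; rewrite lact0 ract0. Qed.

Lemma conj1 : dilog_conj 1 1.
Proof. by rewrite /dilog_conj lact1 ract1. Qed.

Lemma conjM g1 h1 g2 h2 :
  dilog_conj g1 h1 -> dilog_conj g2 h2 -> dilog_conj (g1 * g2) (h1 * h2).
Proof. by rewrite /dilog_conj => E1 E2; rewrite lactM E2 -lractA E1 ractM. Qed.

Lemma conj_sum (I : eqType) (r : seq I) (f g : I -> X) :
  (forall i, i \in r -> dilog_conj (f i) (g i)) ->
  dilog_conj (\sum_(i <- r) f i) (\sum_(i <- r) g i).
Proof.
elim: r => [|i r IH] fg; first by rewrite !big_nil; apply: conj0.
rewrite !big_cons; apply: conjD; first by apply: fg; rewrite mem_head.
by apply: IH => j jr; apply: fg; rewrite inE jr orbT.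
Qed.

(** Psi has constant term 1 and otherwise only terms of positive degree, so a term of x of lowest
    degree survives multiplication by Psi on either side. *)
Lemma dilog_lead x : x != 0 -> exists2 n, n \in supp x &
  lact x (dilog 0) n = iota (coef x n) /\ ract (dilog 0) x n = iota (coef x n).
Proof.
have [l lD le] := dir_lam de.
move=> /torus_neq0[n0 n0x].
have [n nx nmin] : exists2 n, n \in supp x & forall p, p \in supp x -> (l n <= l p)%R.
  elim: (supp x) n0 n0x => // a s IH n0 _.
  case: s IH => [|b s] IH.
    by exists a => [|p]; rewrite ?mem_head // inE => /eqP ->.
  have [n ns nmin] := IH b (mem_head _ _).
  case: (leP (l a) (l n)) => an.
    exists a => [|p]; rewrite ?mem_head // inE => /predU1P[->//|/nmin].
    exact: le_trans.
  exists n => [|p]; first by rewrite inE ns orbT.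
  by rewrite inE => /predU1P[->|/nmin//]; apply: ltW.
have out p : p \in supp x -> p != n -> dilog 0 (n - p) = 0.
  move=> mx mn; have [[[|k] E]|//] := dilogP 0 (n - p).
    by move/eqP: E mn; rewrite mulr0n subr_eq0 eq_sym => /eqP ->; rewrite eqxx.
  have := congr1 l E; rewrite (addfB lD) (addfMn lD) le.
  by have := nmin _ mx; lia.
exists n => //; split.
  rewrite (@lactE _ _ _ _ _ (supp x)) ?supp_uniq // (bigD1_seq n) ?supp_uniq //= big_seq_cond big1 => [|m /andP[mx mn]].
    by rewrite subrr dilog00 formxx oppr0 qp0 !mulr1 addr0.
  by rewrite out ?mulr0.
rewrite (@ractE _ _ _ _ _ (supp x)) ?supp_uniq // (bigD1_seq n) ?supp_uniq //= big_seq_cond big1 => [|m /andP[mx mn]].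
  by rewrite subrr dilog00 formxx qp0 !mulr1 addr0.
by rewrite out ?mulr0.
Qed.

Lemma iota_eq0 a : iota a = 0 -> a = 0.
Proof.
by move=> ia; apply/eqP; apply/negP => /negP/iota_unit; rewrite ia unitr0.
Qed.

Lemma lact_dilog_inj x : lact x (dilog 0) = (fun=> 0) -> x = 0.
Proof.
move=> E; apply/eqP; apply/negP => /negP/dilog_lead[n nx [En _]].
by move: nx; rewrite mem_supp (iota_eq0 (a := coef x n)) ?eqxx // -En E.
Qed.

Lemma ract_dilog_inj x : ract (dilog 0) x = (fun=> 0) -> x = 0.
Proof.
move=> E; apply/eqP; apply/negP => /negP/dilog_lead[n nx [_ En]].
by move: nx; rewrite mem_supp (iota_eq0 (a := coef x n)) ?eqxx // -En E.
Qed.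

(** Psi is not a zero divisor, so in [dilog_conj] each of the two elements determines the other. *)
Lemma conj_injr g h1 h2 : dilog_conj g h1 -> dilog_conj g h2 -> h1 = h2.
Proof.
move=> E1 E2; apply/eqP; rewrite -subr_eq0; apply/eqP/lact_dilog_inj.
have := conjB E1 E2; rewrite subrr /dilog_conj => ->.
by apply/funext => n; rewrite ract0.
Qed.

Lemma conj_injl g1 g2 h : dilog_conj g1 h -> dilog_conj g2 h -> g1 = g2.
Proof.
move=> E1 E2; apply/eqP; rewrite -subr_eq0; apply/eqP/ract_dilog_inj.
have := conjB E1 E2; rewrite subrr /dilog_conj => <-.
by apply/funext => n; rewrite lact0.
Qed.

Section Proj.
Variables (P : pred L) (Pe : forall n, P (n + e) = P n).

Lemma proj_invariant n m : P (n + e *+ m) = P n.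
Proof. by elim: m => [|m IH]; rewrite ?mulr0n ?addr0 // mulrSr addrA Pe. Qed.

(** Psi moves exponents only by multiples of e, hence respects an e-invariant set of exponents. *)
Lemma lact_proj x n : lact (proj P x) (dilog 0) n = if P n then lact x (dilog 0) n else 0.
Proof.
rewrite (@lactE _ _ _ _ _ (supp x)) ?supp_uniq //; last first.
  by move=> m; rewrite !mem_supp coef_proj; case: ifP; rewrite ?eqxx.
rewrite [RHS](_ : _ = \sum_(m <- supp x)
  if P n then iota (coef x m * qp X (- form m n)) * dilog 0 (n - m) else 0).
  apply: eq_bigr => m _; rewrite coef_proj.
  have [[k /eqP E]|->] := dilogP 0 (n - m); last by rewrite !mulr0 if_same.
  move: E; rewrite subr_eq addrC => /eqP ->; rewrite proj_invariant.
  by case: ifP; rewrite // mul0r rmorph0 mul0r.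
by case: ifP => // _; rewrite big1.
Qed.

Lemma ract_proj x n : ract (dilog 0) (proj P x) n = if P n then ract (dilog 0) x n else 0.
Proof.
rewrite (@ractE _ _ _ _ _ (supp x)) ?supp_uniq //; last first.
  by move=> m; rewrite !mem_supp coef_proj; case: ifP; rewrite ?eqxx.
rewrite [RHS](_ : _ = \sum_(m <- supp x)
  if P n then iota (coef x m * qp X (form m n)) * dilog 0 (n - m) else 0).
  apply: eq_bigr => m _; rewrite coef_proj.
  have [[k /eqP E]|->] := dilogP 0 (n - m); last by rewrite !mulr0 if_same.
  move: E; rewrite subr_eq addrC => /eqP ->; rewrite proj_invariant.
  by case: ifP; rewrite // mul0r rmorph0 mul0r.
by case: ifP => // _; rewrite big1.
Qed.

Lemma conj_proj g h : dilog_conj g h -> dilog_conj (proj P g) (proj P h).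
Proof.
by rewrite /dilog_conj => E; apply/funext => n; rewrite lact_proj ract_proj E.
Qed.

End Proj.

End Dilogarithm.

(** * Isometries and the change of sign of a mutation *)

Section Push.
Variables (R : comNzRingType) (D1 D2 : seed_data).
Variables (X : torus R D1) (Y : torus R D2).
Variables (S : unitRingType) (iota : {rmorphism R -> S}).
Variable phi : lattice D1 -> lattice D2.
Hypothesis phiD : additive_fun phi.
Hypothesis phi_inj : injective phi.
Hypothesis phi_form : forall u v, skewform (phi u) (phi v) = skewform u v.
Hypothesis qpXY : forall r, qp X r = qp Y r.
Implicit Types x : X.

(** Serves twice: for the automorphism [shear] of one lattice and for the embedding into
    [extension]. *)
Definition push x : Y := \sum_(n <- supp x) coef x n *: mono Y (phi n).

Lemma coef_push x n : coef (push x) (phi n) = coef x n.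
Proof.
rewrite coef_sum [in RHS](torus_sum x) coef_sum; apply: eq_bigr => m _.
by rewrite !coefZ !coef_mono (inj_eq phi_inj).
Qed.

Lemma coef_push_out x p : (forall n, p <> phi n) -> coef (push x) p = 0.
Proof.
move=> out; rewrite coef_sum big1 // => m _; rewrite coefZ coef_mono.
by case: eqP => [/esym/out//|_]; rewrite mulr0.
Qed.

Lemma push_imageP p : (exists n, p = phi n) \/ (forall n, p <> phi n).
Proof.
case: (pselect (exists n, p = phi n)) => N; [by left|right => n E].
by apply: N; exists n.
Qed.

Lemma pushD x y : push (x + y) = push x + push y.
Proof.
apply: torusP => p; rewrite coefD; have [[n ->]|out] := push_imageP p.
  by rewrite !coef_push coefD.
by rewrite !coef_push_out ?addr0.
Qed.

Lemma pushZ c x : push (c *: x) = c *: push x.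
Proof.
apply: torusP => p; rewrite coefZ; have [[n ->]|out] := push_imageP p.
  by rewrite !coef_push coefZ.
by rewrite !coef_push_out ?mulr0.
Qed.

Lemma push0 : push 0 = 0.
Proof. by rewrite -(scale0r (0 : X)) pushZ scale0r. Qed.

Lemma push_mono n : push (mono X n) = mono Y (phi n).
Proof.
apply: torusP => p; have [[m ->]|out] := push_imageP p.
  by rewrite coef_push !coef_mono (inj_eq phi_inj).
by rewrite coef_push_out // coef_mono; case: eqP => // /esym/out.
Qed.

Lemma push1 : push 1 = 1.
Proof. by rewrite -(mono0 X) push_mono (addf0 phiD) mono0. Qed.

Lemma pushM x y : push (x * y) = push x * push y.
Proof.
elim/torus_ind: x => [|x1 x2 IH1 IH2|c m].
- by rewrite mul0r push0 mul0r.
- by rewrite mulrDl !pushD IH1 IH2 mulrDl.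
elim/torus_ind: y => [|y1 y2 IH1 IH2|d p].
- by rewrite mulr0 push0 mulr0.
- by rewrite mulrDr !pushD IH1 IH2 mulrDr.
rewrite -scalerAl -scalerAr monoM !pushZ !push_mono -scalerAl -scalerAr monoM.
by rewrite phiD phi_form qpXY.
Qed.

Lemma push_sum (I : Type) (r : seq I) (f : I -> X) :
  push (\sum_(i <- r) f i) = \sum_(i <- r) push (f i).
Proof. exact: (big_morph push pushD push0). Qed.

Variables (d : nat) (e : lattice D1).
Hypothesis de : direction d e.

Lemma push_dir : direction d (phi e) ->
  forall n, dilog Y iota d (phi e) 0 (phi n) = dilog X iota d e 0 n.
Proof.
move=> de' n.
have coefE m : dilog_coef Y iota d m = dilog_coef X iota d m.
  by elim: m => //= m ->; rewrite /qr !qpXY.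
have [[m ->]|out] := dilogP X iota d e 0 n.
  by rewrite (addfMn phiD) !dilogE // coefE /qr !qpXY.
have [[m]|->//] := dilogP Y iota d (phi e) 0 (phi n).
rewrite -(addfMn phiD) => /phi_inj E.
by move: out; rewrite E !(addfMn phiD) !dilogE // coefE /qr !qpXY.
Qed.

Lemma conj_push g h : direction d (phi e) ->
  dilog_conj iota d e g h <-> dilog_conj iota d (phi e) (push g) (push h).
Proof.
move=> de'; rewrite /dilog_conj.
have lactE' x n : lact iota (push x) (dilog Y iota d (phi e) 0) (phi n) =
    lact iota x (dilog X iota d e 0) n.
  elim/torus_ind: x => [|x y IHx IHy|c m]; first by rewrite push0 !lact0.
    by rewrite pushD !lactD IHx IHy.
  rewrite pushZ !lactZ push_mono !lact_mono phi_form qpXY.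
  by rewrite -(addfB phiD) push_dir.
have ractE' x n : ract iota (dilog Y iota d (phi e) 0) (push x) (phi n) =
    ract iota (dilog X iota d e 0) x n.
  elim/torus_ind: x => [|x y IHx IHy|c m]; first by rewrite push0 !ract0.
    by rewrite pushD !ractD IHx IHy.
  rewrite pushZ !ractZ push_mono !ract_mono phi_form qpXY.
  by rewrite -(addfB phiD) push_dir.
split=> E; apply/funext => p; last by rewrite -lactE' -ractE' E.
have [[n ->]|out] := push_imageP p; first by rewrite lactE' ractE' E.
(* Outside the image of [phi] both sides vanish: p - phi(n) = m phi(e) would put p in the image. *)
have dil0 n : dilog Y iota d (phi e) 0 (p - phi n) = 0.
  have [[m]|//] := dilogP Y iota d (phi e) 0 (p - phi n).
  move/eqP; rewrite subr_eq -(addfMn phiD) -phiD => /eqP Ep.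
  by case: (out _ Ep).
have -> : lact iota (push h) (dilog Y iota d (phi e) 0) p = 0.
  elim/torus_ind: (h) => [|x y IHx IHy|c m]; first by rewrite push0 !lact0.
    by rewrite pushD !lactD IHx IHy addr0.
  by rewrite pushZ !lactZ push_mono !lact_mono dil0 !mulr0.
elim/torus_ind: (g) => [|x y IHx IHy|c m]; first by rewrite push0 !ract0.
  by rewrite pushD !ractD -IHx -IHy addr0.
by rewrite pushZ !ractZ push_mono !ract_mono dil0 !mulr0.
Qed.

Lemma push_surj : (forall p, exists n, p = phi n) -> forall y, exists x, y = push x.
Proof.
move=> phi_surj y; elim/torus_ind: y => [|y1 y2 [x1 ->] [x2 ->]|c p].
- by exists 0; rewrite push0.
- by exists (x1 + x2); rewrite pushD.
by have [n ->] := phi_surj p; exists (c *: mono X n); rewrite pushZ push_mono.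
Qed.

End Push.

(** The monomial transformation by which the two choices of sign in the tropical part of a mutation
    differ. *)
Definition shear (D : seed_data) (d : nat) (e n : lattice D) : lattice D :=
  n + e *~ cexp d e n.

Section Shear.
Variables (D : seed_data) (d : nat) (e : lattice D).
Hypothesis de : direction d e.

Lemma shearD : additive_fun (shear d e).
Proof. by move=> u v; rewrite /shear (cexpD de) mulrzDr addrACA. Qed.

Lemma shear_self : shear d e e = e.
Proof. by rewrite /shear (cexp_self de) mulr0z addr0. Qed.

Lemma shear_inj : injective (shear d e).
Proof.
move=> u v E; have : cexp d e u = cexp d e v.
  have := congr1 (cexp d e) E; rewrite /shear !(cexpD de) !(addfMz (cexpD de)).
  by rewrite (cexp_self de) !mul0rz !addr0.
by move: E; rewrite /shear => /[swap] -> /addIr.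
Qed.

Lemma shear_surj p : exists n, p = shear d e n.
Proof.
exists (p - e *~ cexp d e p); rewrite /shear (addfB (cexpD de)) (addfMz (cexpD de)).
by rewrite (cexp_self de) mul0rz subr0 subrK.
Qed.

Lemma shear_form u v : skewform (shear d e u) (shear d e v) = skewform u v.
Proof.
rewrite /shear !formDl !formDr !formMzl !formMzr formxx (form_skew u e).
by rewrite !(cexp_form de); ring.
Qed.

Lemma direction_opp : direction d (- e).
Proof.
split; [exact: dir_gt0 de|exact: dir_dvd de|move=> n|].
  by rewrite formNl mulrN rpredN (dir_int de).
have [l lD le] := dir_lam de; exists (fun n => - l n).
  by move=> u v; rewrite lD opprD.
by rewrite (addfN lD) le opprK.
Qed.

Lemma cexp_opp n : cexp d (- e) n = - cexp d e n.
Proof.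
apply: (@intr_inj rat); rewrite rmorphN /= (cexpE direction_opp) (cexpE de).
by rewrite formNl mulrN !opprK.
Qed.

Lemma shear_opp n : shear d (- e) n = shear d e n.
Proof. by rewrite /shear cexp_opp mulrNz mulNrz opprK. Qed.

End Shear.

Section Flip.
Variables (R : comNzRingType) (D : seed_data) (X : torus R D).
Variables (S : unitRingType) (iota : {rmorphism R -> S}).
Hypothesis iota_unit : forall a, a != 0 -> iota a \is a GRing.unit.
Local Notation z := (@mono R D X).

(** Each factor satisfies z^e (1 + q^(-(2r-1)) z^(-e)) = q^(-(2r-1)) (1 + q^(2r-1) z^e), with q =
    q_k, and the first m odd numbers add up to m^2. *)
Lemma dprod_flip (d : nat) (e : lattice D) (de : direction d e) (m : nat) :
  z (e *+ m) * dprod_neg X d (- e) m = qr X d (- (m%:R ^+ 2)) *: dprod_pos X d e m.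
Proof.
have eN : z e * z (- e) = 1 by rewrite monoM formNr formxx !oppr0 qp0 scale1r subrr mono0.
have Ne : z (- e) * z e = 1 by rewrite monoM formNl formxx !oppr0 qp0 scale1r addNr mono0.
elim: m => [|m IH].
  by rewrite /dprod_neg /dprod_pos !big_geq // mulr0n mono0 mulr1 expr0n oppr0 qr0 scale1r.
have -> : z (e *+ m.+1) = z (e *+ m) * z e.
  by rewrite monoM formMnl formxx mulr0 oppr0 qp0 scale1r mulrSr.
have ec : GRing.comm (z e) (dprod_neg X d (- e) m).
  apply: commr_prod => i _; apply: commrD; first exact: commr1.
  by rewrite /GRing.comm -scalerAl -scalerAr eN Ne.
rewrite dprod_negS mulrA -[_ * z e * _]mulrA ec mulrA IH -mulrA.
have -> : z e * dfactor X d (- e) (- (2 * m%:R + 1)) =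
    qr X d (- (2 * m%:R + 1)) *: dfactor X d e (2 * m%:R + 1).
  rewrite /dfactor mulrDr mulr1 -scalerAr eN scalerDr scalerA (qrM X de).
    by rewrite addNr qr0 scale1r addrC.
  by rewrite rpredN rpredD ?rpred1 // rpredM ?natr_int.
rewrite -scalerAl -scalerAr scalerA (qrM X de); last by rewrite rpredN rpredX ?natr_int.
rewrite dprod_posS; congr (qr X d _ *: _); first by rewrite -natr1; ring.
by apply/esym/commr_prod => i _; apply: dfactor_comm.
Qed.

Lemma mono_dprod_flip (d : nat) (e n : lattice D) (m : nat) (de : direction d e) :
  cexp d e n = m -> z (n + e *+ m) * dprod_neg X d (- e) m = z n * dprod_pos X d e m.
Proof.
move=> cm; have formE : skewform n (e *+ m) = m%:R ^+ 2 / d%:R.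
  by rewrite formMnr form_skew (cexp_form de) cm -pmulrn; ring.
have -> : z (n + e *+ m) = qr X d (m%:R ^+ 2) *: (z n * z (e *+ m)).
  rewrite monoM scalerA formE -mulNr -/(qr X d _) (qrM X de) ?rpredX ?natr_int //.
  by rewrite subrr qr0 scale1r.
rewrite -scalerAl -mulrA (dprod_flip de) -scalerAr scalerA (qrM X de).
  by rewrite subrr qr0 scale1r.
by rewrite rpredX ?natr_int.
Qed.

Lemma proj_split (P : pred (lattice D)) (x : X) : x = proj P x + proj (predC P) x.
Proof.
by apply: torusP => n; rewrite coefD !coef_proj /=; case: (P n); rewrite ?addr0 ?add0r.
Qed.

(* Psi(z^e) Psi(z^-e) acts on the torus by the automorphism [shear].          *)
Lemma conj_flip (d : nat) (e : lattice D) (de : direction d e) (g h : X) :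
  dilog_conj iota d e g h -> dilog_conj iota d (- e) h (push X (shear d e) g).
Proof.
(* The exponent c is constant along e, so the parts with c >= 0 and with c < 0 can be treated
   separately. On the first, the monomials of g have Laurent images; on the second, those of h have
   Laurent preimages. Both cases then reduce to [mono_dprod_flip]. *)
move=> gh; pose P : pred (lattice D) := fun n => 0 <= cexp d e n.
have Pe n : P (n + e) = P n by rewrite /P (cexpD de) (cexp_self de) addr0.
have Ce n : predC P (n + e) = predC P n by rewrite /= Pe.
have de' := direction_opp de.
have shD := shearD de; have shI := shear_inj de.
rewrite (proj_split P g) (proj_split P h) pushD //; apply: conjD.
- have := conj_proj Pe gh; set g' := proj P g; set h' := proj P h => gh'.
  have g'P n : n \in supp g' -> P n.
    by rewrite mem_supp coef_proj; case: ifP => //; rewrite eqxx.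
  have -> : h' = \sum_(n <- supp g') coef g' n *: (z n * dprod_pos X d e `|cexp d e n|%N).
    apply: (conj_injr iota_unit de gh'); rewrite {1}[g']torus_sum.
    apply: conj_sum => n /g'P Pn; apply: conjZ; exact: conj_pos.
  apply: conj_sum => n /g'P Pn; apply: conjZ.
  have cE : cexp d e n = `|cexp d e n|%N by rewrite gez0_abs.
  rewrite -(mono_dprod_flip de cE) /shear {3}cE -pmulrn.
  have := @conj_neg _ _ X _ _ iota_unit _ _ de' (n + e *+ `|cexp d e n|%N).
  rewrite (cexp_opp de) (cexpD de) (addfMn (cexpD de)) (cexp_self de) mul0rn addr0.
  by rewrite abszN oppr_le0; apply.
have := conj_proj Ce gh; set g' := proj _ g; set h' := proj _ h => gh'.
have h'P n : n \in supp h' -> cexp d e n < 0.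
  by rewrite mem_supp coef_proj /= /P -ltNge; case: ifP => //; rewrite eqxx.
have -> : g' = \sum_(n <- supp h') coef h' n *: (z n * dprod_neg X d e `|cexp d e n|%N).
  apply: (conj_injl iota_unit de (h := h')) => //; rewrite [X in dilog_conj _ _ _ _ X]torus_sum.
  apply: conj_sum => n /h'P /ltW Pn; apply: conjZ; exact: conj_neg.
rewrite push_sum // {1}[h']torus_sum; apply: conj_sum => n /h'P Pn.
rewrite pushZ //; apply: conjZ.
rewrite pushM ?push_mono //; last exact: shear_form.
have cE : cexp d (- e) n = `|cexp d e n|%N by rewrite (cexp_opp de); lia.
have -> : push X (shear d e) (dprod_neg X d e `|cexp d e n|%N) =
    dprod_neg X d (- - e) `|cexp d e n|%N.
  rewrite opprK; elim: `|_|%N => [|m IH].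
    by rewrite /dprod_neg big_geq // push1.
  rewrite !dprod_negS pushM ?IH //; last exact: shear_form.
  by rewrite /dfactor pushD // pushZ // push1 // push_mono // (shear_self de).
have -> : shear d e n = n + (- e) *+ `|cexp d e n|%N.
  by rewrite -(shear_opp de) /shear cE -pmulrn.
rewrite (mono_dprod_flip de' cE).
have := @conj_pos _ _ X _ _ iota_unit _ _ de' n; rewrite (cexp_opp de) abszN.
by apply; rewrite oppr_ge0 ltW.
Qed.

End Flip.

(** * Laurent expansions in rank two *)

Section TorusProduct.
Variables (R : comNzRingType) (D : seed_data) (X : torus R D).
Local Notation L := (lattice D).
Local Notation z := (@mono R D X).

Lemma coefMl (x y : X) n : coef (x * y) n =
  \sum_(m <- supp x) coef x m * (qp X (- skewform m n) * coef y (n - m)).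
Proof.
rewrite {1}[x]torus_sum mulr_suml coef_sum; apply: eq_bigr => m _.
by rewrite -scalerAl coefZ coef_monoMl.
Qed.

Lemma coefMr (x y : X) n : coef (x * y) n =
  \sum_(m <- supp y) coef y m * (qp X (skewform m n) * coef x (n - m)).
Proof.
rewrite {1}[y]torus_sum mulr_sumr coef_sum; apply: eq_bigr => m _.
by rewrite -scalerAr coefZ coef_monoMr.
Qed.

Lemma supp_bound (l : L -> int) (x : X) : exists b : int, forall n, n \in supp x -> b <= l n.
Proof.
elim: (supp x) => [|a s [b bs]]; first by exists 0.
exists (Num.min b (l a)) => n; rewrite inE => /predU1P[->|/bs bn].
  by rewrite ge_min lexx orbT.
by rewrite ge_min bn.
Qed.

Lemma torus_choose (Q : L -> R -> Prop) (s : seq L) : uniq s ->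
  (forall n, n \in s -> exists c, Q n c) ->
  exists x : X, (forall n, n \in s -> Q n (coef x n)) /\
                (forall n, n \notin s -> coef x n = 0).
Proof.
elim: s => [|a s IH] /=; first by exists 0; split=> // n _; rewrite coef0.
case/andP=> as' us Qs; have [|x [xQ x0]] := IH us.
  by move=> n ns; apply: Qs; rewrite inE ns orbT.
have [|c Qc] := Qs a; first exact: mem_head.
exists (c *: z a + x); split=> n; rewrite inE coefD coefZ coef_mono.
  case/predU1P=> [->|ns]; first by rewrite eqxx mulr1 (x0 a) ?addr0.
  case: eqP as' => [->|_ _]; first by rewrite ns.
  by rewrite mulr0 add0r; apply: xQ.
by rewrite negb_or eq_sym => /andP[/negbTE-> /x0->]; rewrite mulr0 addr0.
Qed.

End TorusProduct.

(** * Elements that stay Laurent after one mutation *)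

Section Expandable.
Variables (R : comNzRingType) (D : seed_data) (X : torus R D).
Variables (S : unitRingType) (iota : {rmorphism R -> S}).
Hypothesis iota_unit : forall a, a != 0 -> iota a \is a GRing.unit.
Local Notation L := (lattice D).
Local Notation form := (@skewform D).
Local Notation z := (@mono R D X).
Local Notation lact := (@lact R D X S iota).
Local Notation ract := (@ract R D X S iota).
Variables (d : nat) (e : L).
Local Notation psi := (dilog X iota d e 0).
Implicit Types (x y g h : X) (n p : L) (m : nat).

Definition expandable h : Prop := exists g : X, dilog_conj iota d e g h.

Hypothesis de : direction d e.

Lemma iota_neq0M a b : a != 0 -> b != 0 -> a * b != 0 :> R.
Proof.
move=> /iota_unit ua /iota_unit ub; apply/eqP => /(congr1 iota).
rewrite rmorphM rmorph0 => E.
by move: ub; rewrite -[iota b](mulKr ua) E mulr0 unitr0.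
Qed.

Lemma expandable0 : expandable 0.
Proof. by exists 0; apply: conj0. Qed.

Lemma expandableD x y : expandable x -> expandable y -> expandable (x + y).
Proof. by move=> [g gx] [h hy]; exists (g + h); apply: conjD. Qed.

Lemma expandableZ c x : expandable x -> expandable (c *: x).
Proof. by move=> [g gx]; exists (c *: g); apply: conjZ. Qed.

Lemma expandableB x y : expandable x -> expandable y -> expandable (x - y).
Proof. by move=> ex ey; rewrite -scaleN1r; apply/expandableD/expandableZ. Qed.

Lemma expandableM x y : expandable x -> expandable y -> expandable (x * y).
Proof. by move=> [g gx] [h hy]; exists (g * h); apply: conjM. Qed.

Lemma expandable_sum (I : eqType) (r : seq I) (f : I -> X) :
  (forall i, i \in r -> expandable (f i)) -> expandable (\sum_(i <- r) f i).
Proof.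
elim: r => [|i r IH] fr; first by rewrite big_nil; apply: expandable0.
rewrite big_cons; apply: expandableD; first by apply: fr; rewrite mem_head.
by apply: IH => j jr; apply: fr; rewrite inE jr orbT.
Qed.

Lemma expandable_proj (P : pred L) x : (forall n, P (n + e) = P n) ->
  expandable x -> expandable (proj P x).
Proof. by move=> Pe [g gx]; exists (proj P g); apply: conj_proj. Qed.

Lemma cexp_le0 n : (cexp d e n <= 0) = (0 <= form e n).
Proof.
by rewrite -(ler_int rat) (cexpE de) oppr_le0 pmulr_rge0 // ltr0n (dir_gt0 de).
Qed.

Lemma expandable_mono n : 0 <= form e n -> expandable (z n).
Proof. by rewrite -cexp_le0 => /(conj_neg X iota_unit de); eexists; eassumption. Qed.

Lemma dprod_pos_split m m' : (m <= m')%N ->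
  exists y, dprod_pos X d e m' = dprod_pos X d e m * y.
Proof.
move=> /subnKC <-; elim: (m' - m)%N => [|k [y IH]].
  by exists 1; rewrite addn0 mulr1.
exists (dfactor X d e (2 * (m + k)%N%:R + 1) * y); rewrite addnS dprod_posS IH !mulrA.
by congr (_ * _); apply/commr_prod => i _; apply: dfactor_comm.
Qed.

Lemma dprod_pos_commute m j :
  lact (dprod_pos X d e m) (dilog X iota d e j) = ract (dilog X iota d e j) (dprod_pos X d e m).
Proof.
elim: m => [|m IH]; first by rewrite /dprod_pos big_geq // lact1 ract1.
by rewrite dprod_posS lactM IH -lractA (dfactor_commute X) // ractM.
Qed.

(** Psi^-1 z^n Psi is z^n times a polynomial in z^e or times the inverse of some [dprod_pos], so a
    long enough [dprod_pos] clears the denominators of Psi^-1 x Psi. *)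
Lemma conj_denominator x : exists M : nat, forall m, (M <= m)%N ->
  exists g, ract (lact x psi) (dprod_pos X d e m) = ract psi g.
Proof.
elim/torus_ind: x => [|x y [M1 IH1] [M2 IH2]|c n].
- exists 0%N => m _; exists 0; apply/funext => n; rewrite ract0 lractA lact0 //.
- exists (maxn M1 M2) => m; rewrite geq_max => /andP[/IH1[g1 E1] /IH2[g2 E2]].
  exists (g1 + g2); have /funext -> := lactD iota x y psi; rewrite ractDr E1 E2.
  by apply/funext => n; rewrite ractD.
exists `|cexp d e n|%N => m cm; case: (leP 0 (cexp d e n)) => c0.
  have [y E] := dprod_pos_split cm.
  exists (c *: (z n * y)); apply/funext => p; rewrite lractA lactZ ractZ E !ractM.
  rewrite -lractA; congr (_ * _); rewrite -dprod_pos_commute -lactM.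
  have := conj_pos X iota_unit de c0; rewrite /dilog_conj => ->.
  by [].
exists (c *: (z n * dprod_neg X d e `|cexp d e n|%N * dprod_pos X d e m)).
apply/funext => p; rewrite lractA lactZ ractZ -lractA.
have := conj_neg X iota_unit de (ltW c0); rewrite /dilog_conj => ->.
by rewrite -ractM.
Qed.

Definition divisible (a : R) x := exists y, x = a *: y.

(** The factor 1 + q_k^r z^e has lowest coefficient 1, so the coefficients of y are found divisible
    by induction on the degree. *)
Lemma divisible_dfactor a r y : divisible a (y * dfactor X d e r) -> divisible a y.
Proof.
case=> g E; have [l lD le] := dir_lam de; have [b yb] := supp_bound l y.
have div k : forall n, (l n - b < k%:Z)%R -> exists c, coef y n = a * c.
  elim: k => [|k IH] n lk.
    exists 0; rewrite mulr0 supp_nil //; apply/negP => /yb; lia.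
  have [|c cE] := IH (n - e); first by rewrite (addfB lD) le; lia.
  exists (coef g n - qr X d r * (qp X (form e n) * c)).
  have := congr1 (fun x => coef x n) E.
  rewrite mulrDr mulr1 -scalerAr coefD !coefZ coef_monoMr cE mulrBr => <-.
  by ring.
have [|y' [y'P y'0]] := @torus_choose _ _ X (fun n c => coef y n = a * c) (supp y) (supp_uniq y).
  by move=> n _; apply: (div (absz (l n - b)).+1); lia.
exists y'; apply: torusP => n; rewrite coefZ.
case ny: (n \in supp y); first exact: y'P.
by rewrite supp_nil ?ny // y'0 ?ny // mulr0.
Qed.

Lemma divisible_dprod a m y : divisible a (y * dprod_pos X d e m) -> divisible a y.
Proof.
elim: m y => [|m IH] y; first by rewrite /dprod_pos big_geq // mulr1.
by rewrite dprod_posS mulrA => /IH/divisible_dfactor.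
Qed.

(** If y is Psi^-1 (a x) Psi and Q a denominator of Psi^-1 x Psi, then a divides y Q, hence y. This
    permits dividing by the common denominator of a truncation of Psi. *)
Lemma expandable_sat a x : a != 0 -> expandable (a *: x) -> expandable x.
Proof.
move=> a0 [y yx]; have [M Mx] := conj_denominator x; have [g Eg] := Mx M (leqnn M).
have [|y' Ey] := @divisible_dprod a M y.
  exists g; have E : ract psi (y * dprod_pos X d e M) = ract psi (a *: g).
    rewrite ractM -yx; have /funext -> := lactZ iota a x psi; rewrite ractZr Eg.
    by apply/funext => n; rewrite ractZ.
  apply/eqP; rewrite -subr_eq0; apply/eqP/(ract_dilog_inj iota_unit de).
  by apply/funext => n; rewrite ractD E -scaleN1r (ractZ _ (- 1)) rmorphN rmorph1 mulN1r subrr.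
exists y'; apply/funext => n; have := congr1 (fun f => f n) yx.
rewrite Ey /= lactZ ractZ => /(congr1 ( *%R (iota a)^-1)).
by rewrite !mulKr ?iota_unit.
Qed.

End Expandable.

(** * Two directions: conjugation along e preserves expandability along f *)

Section RankTwo.
Variables (R : comNzRingType) (D : seed_data) (X : torus R D).
Variables (S : unitRingType) (iota : {rmorphism R -> S}).
Hypothesis iota_unit : forall a, a != 0 -> iota a \is a GRing.unit.
Local Notation L := (lattice D).
Local Notation form := (@skewform D).
Local Notation z := (@mono R D X).
Implicit Types (x y g h : X) (n p : L) (m : nat).

Variables (d : nat) (e : L) (de : direction d e).
Variables (l : L -> int) (lD : additive_fun l) (le : l e = 1).

(** The scalar a is a product of denominators q_k^(2m) - 1; after scaling by it the first M
    coefficients of Psi lie in R. *)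
Lemma dilog_truncation M : exists2 a, a != 0 & exists theta : nat -> R,
  theta 0%N = a /\
  forall m, (m < M)%N -> iota a * dilog_coef X iota d m = iota (theta m).
Proof.
elim: M => [|M [a a0 [theta [th0 IH]]]].
  by exists 1; [exact: oner_neq0|exists (fun=> 1)].
have q1 m : qr X d (2 * m.+1%:R) - 1 != 0.
  rewrite subr_eq0; apply/eqP => E.
  have /qp_neq1/(_ E)/eqP : qint D (2 * m.+1%:R / d%:R).
    by apply: (qint_divZ de); rewrite rpredM ?natr_int.
  by rewrite mulf_eq0 invr_eq0 (negbTE (dir_d_neq0 de)) orbF mulf_eq0 !pnatr_eq0.
case: M IH => [|M] IH.
  exists 1; first exact: oner_neq0; exists (fun=> 1); split=> // m.
  by rewrite ltnS leqn0 => /eqP ->; rewrite mulr1.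
exists (a * (qr X d (2 * M.+1%:R) - 1)); first exact: (iota_neq0M iota_unit).
exists (fun m => if m == M.+1 then qr X d 1 * theta M
                 else theta m * (qr X d (2 * M.+1%:R) - 1)).
split=> [|m]; first by rewrite th0.
rewrite ltnS leq_eqVlt => /predU1P[->|mM].
  rewrite eqxx rmorphM /= -mulrA mulVKr ?iota_unit // rmorphM -IH //.
  by rewrite !mulrA -!rmorphM mulrC.
by rewrite (ltn_eqF mM) [a * _]mulrC [theta m * _]mulrC !rmorphM -mulrA IH.
Qed.

Definition theta_sum (theta : nat -> R) M : X := \sum_(k < M) theta k *: z (e *+ k).

Lemma coef_theta M (theta : nat -> R) m : (m < M)%N ->
  coef (theta_sum theta M) (e *+ m) = theta m.
Proof.
move=> mM; rewrite coef_sum (bigD1 (Ordinal mM)) //= coefZ coef_mono eqxx mulr1.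
rewrite big1 ?addr0 // => k km; rewrite coefZ coef_mono; case: eqP => [E|_].
  by case/eqP: km; apply/val_inj/(dir_mulrn_inj de).
by rewrite mulr0.
Qed.

Lemma coef_theta_out M theta p : (forall m, p <> e *+ m) -> coef (theta_sum theta M) p = 0.
Proof.
move=> out; rewrite coef_sum big1 // => k _; rewrite coefZ coef_mono.
by case: eqP => [/esym/out//|_]; rewrite mulr0.
Qed.

Section Truncated.
Variables (M : nat) (a : R) (theta : nat -> R).
Hypothesis thetaE : forall m, (m < M)%N -> iota a * dilog_coef X iota d m = iota (theta m).
Local Notation psi := (dilog X iota d e 0).

Lemma iota_theta p : l p < M -> iota (coef (theta_sum theta M) p) = iota a * psi p.
Proof.
move=> lp; case: (pselect (exists m : nat, p = e *+ m)) => [[m E]|out].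
  move: lp; rewrite E (addfMn lD) le => lm.
  have mM : (m < M)%N by lia.
  by rewrite coef_theta // dilogE // mulr0 mul0r qr0 rmorph1 mul1r thetaE.
have out' m : p <> e *+ m by move=> E; apply: out; exists m.
by rewrite coef_theta_out // dilog_out // rmorph0 mulr0.
Qed.

Lemma lact_theta x n : (forall p, p \in supp x -> l n - l p < M) ->
  iota (coef (x * theta_sum theta M) n) = iota a * lact iota x psi n.
Proof.
move=> xM; rewrite coefMl rmorph_sum mulr_sumr; apply: eq_big_seq => p px.
by rewrite iotaC -iota_theta ?(addfB lD) ?xM // -rmorphM mulrA.
Qed.

Lemma ract_theta x n : (forall p, p \in supp x -> l n - l p < M) ->
  iota (coef (theta_sum theta M * x) n) = iota a * ract iota psi x n.
Proof.
move=> xM; rewrite coefMr rmorph_sum mulr_sumr; apply: eq_big_seq => p px.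
by rewrite iotaC -iota_theta ?(addfB lD) ?xM // -rmorphM mulrA.
Qed.

(** In low enough degree the products involve only coefficients of Psi before the cut, so the
    truncation satisfies the same relation there. *)
Lemma conj_theta g h n : dilog_conj iota d e g h ->
  (forall p, p \in supp g -> l n - l p < M) ->
  (forall p, p \in supp h -> l n - l p < M) ->
  coef (h * theta_sum theta M) n = coef (theta_sum theta M * g) n.
Proof.
move=> gh gM hM; apply/eqP; rewrite -subr_eq0; apply/eqP/(iota_eq0 iota_unit).
by rewrite rmorphB lact_theta // ract_theta // gh subrr.
Qed.

End Truncated.

Variables (d' : nat) (f : L) (df : direction d' f).
Hypothesis lf : l f = 0.
Hypothesis fe : 0 <= form f e.
Local Notation exp := (@expandable R D X S iota d' f).
Local Notation comp i := (@proj R D X (fun n : L => l n == i)).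

Lemma expandable_comp i x : exp x -> exp (comp i x).
Proof. by apply: expandable_proj => // n; rewrite lD lf addr0. Qed.

Lemma proj0 (P : pred L) : proj P (0 : X) = 0.
Proof. by apply: torusP => n; rewrite coef_proj coef0 if_same. Qed.

Lemma projD (P : pred L) x y : proj P (x + y) = proj P x + proj P y.
Proof. by apply: torusP => n; rewrite coefD !coef_proj coefD; case: ifP; rewrite ?addr0. Qed.

Lemma projZ (P : pred L) c x : proj P (c *: x) = c *: proj P x.
Proof. by apply: torusP => n; rewrite coefZ !coef_proj coefZ; case: ifP; rewrite ?mulr0. Qed.

Lemma comp_eq0 i x b : (forall n, n \in supp x -> b <= l n) -> i < b -> comp i x = 0.
Proof.
move=> xb ib; apply: torusP => n; rewrite coef_proj coef0; case: eqP => // ln.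
by apply: supp_nil; apply/negP => /xb; lia.
Qed.

(* [A m] is the left or the right multiplication by z^(m e).                  *)
Lemma expandable_descent (A : nat -> X -> X) (theta : nat -> R) M b x :
  theta 0%N != 0 -> (forall y, A 0%N y = y) ->
  (forall m y, exp y -> exp (A m y)) ->
  (forall m i, comp i (A m x) = A m (comp (i - m%:Z) x)) ->
  (forall n, n \in supp x -> b <= l n < b + M.+1%:Z) ->
  (forall i, i < b + M.+1%:Z -> exp (comp i (\sum_(k < M.+1) theta k *: A k x))) ->
  exp x.
Proof.
move=> th0 A0 Aexp Acomp xb sexp.
(* Triangular induction on the degree: the degree i component of the sum is theta(0) times that of
   x, plus images under [A] of lower components of x. The latter are subtracted and theta(0) is
   divided out. *)
have claim k : forall i, i < b + k%:Z -> i < b + M.+1%:Z -> exp (comp i x).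
  elim: k => [|k IH] i ik iM.
    rewrite (@comp_eq0 i x b) //; first exact: expandable0.
      by move=> n /xb/andP[].
    by lia.
  apply: (expandable_sat iota_unit df th0).
  have := sexp i iM; rewrite big_ord_recl /= A0 projD projZ.
  set s := \sum_(j < M) _ => es.
  suff: exp (comp i s) by move=> /(expandableB es); rewrite addrK.
  rewrite (big_morph (comp i) (projD _) (proj0 _)); apply: expandable_sum => j _.
  rewrite projZ; apply/expandableZ; rewrite Acomp; apply/Aexp/IH; rewrite /bump /=; lia.
have -> : x = \sum_(k < M.+1) comp (b + k%:Z) x.
  apply: torusP => n; rewrite coef_sum; under eq_bigr do rewrite coef_proj.
  case nx: (n \in supp x); last by rewrite supp_nil ?nx // big1 // => k _; rewrite if_same.
  have /andP[bn nM] := xb n nx.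
  have kM : (absz (l n - b) < M.+1)%N by lia.
  rewrite (bigD1 (Ordinal kM)) //= big1 ?addr0 => [|k km].
    by rewrite ifT //; apply/eqP; lia.
  by rewrite ifF //; apply: contraNF km => /eqP E; apply/eqP/val_inj => /=; lia.
apply: expandable_sum => k _; apply: (claim M.+1); have := ltn_ord k; lia.
Qed.

Lemma comp_monoMl i m x : comp i (z (e *+ m) * x) = z (e *+ m) * comp (i - m%:Z) x.
Proof.
apply: torusP => n; rewrite coef_proj !coef_monoMl coef_proj.
rewrite (addfB lD) (addfMn lD) le subr_eq; case: eqP => [->|ne].
  by rewrite ifT //; apply/eqP; lia.
by rewrite ifF ?mulr0 //; apply/eqP; lia.
Qed.

Lemma comp_monoMr i m x : comp i (x * z (e *+ m)) = comp (i - m%:Z) x * z (e *+ m).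
Proof.
apply: torusP => n; rewrite coef_proj !coef_monoMr coef_proj.
rewrite (addfB lD) (addfMn lD) le subr_eq; case: eqP => [->|ne].
  by rewrite ifT //; apply/eqP; lia.
by rewrite ifF ?mulr0 //; apply/eqP; lia.
Qed.

Lemma expandable_mono_e m : exp (z (e *+ m)).
Proof. by apply: expandable_mono; rewrite // formMnr mulr_ge0. Qed.

Lemma supp_range (r : seq X) : exists (b : int) (M : nat), forall x n, x \in r -> n \in supp x ->
  b <= l n < b + M.+1%:Z.
Proof.
elim: r => [|x r [b [M IH]]]; first by exists 0, 0%N.
have [b1 xb1] := supp_bound l x.
have [b2 xb2] := supp_bound (fun n => - l n) x.
exists (Num.min b b1), (absz (Num.max (b + M.+1%:Z) (1 - b2) - Num.min b b1)%R) => y n.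
rewrite inE => /predU1P[->|yr] nx.
  by have := xb1 n nx; have := xb2 n nx; lia.
by have := IH y n yr nx; lia.
Qed.

(* z^e is expandable along f because {f, e} >= 0, hence so is, degree by      *)
(* degree and up to a scalar, Psi(z^e), which conjugates g to h.              *)
Lemma expandable_conj g h : dilog_conj iota d e g h -> exp g <-> exp h.
Proof.
move=> gh; have [b [M bM]] := supp_range [:: g; h].
have gb n : n \in supp g -> b <= l n < b + M.+1%:Z by apply: bM; rewrite mem_head.
have hb n : n \in supp h -> b <= l n < b + M.+1%:Z.
  by apply: bM; rewrite !inE eqxx orbT.
have [a a0 [theta [th0 thE]]] := dilog_truncation M.+1.
(* All exponents of g and h have degree at least b, so cutting Psi at degree M + 1 loses nothing
   below degree b + M + 1. *)
have E i : i < b + M.+1%:Z ->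
    comp i (h * theta_sum theta M.+1) = comp i (theta_sum theta M.+1 * g).
  move=> iM; apply: torusP => n; rewrite !coef_proj; case: eqP => // ln.
  by apply: (conj_theta thE gh) => p => [/gb|/hb]; lia.
split=> ex.
- apply: (@expandable_descent (fun m y => y * z (e *+ m)) theta M b h) => //.
  + by rewrite th0.
  + by move=> y; rewrite mulr0n mono0 mulr1.
  + by move=> m y ey; apply: expandableM => //; apply: expandable_mono_e.
  + by move=> m i; exact: comp_monoMr.
  + move=> i iM; have -> : \sum_(k < M.+1) theta k *: (h * z (e *+ k)) =
        h * theta_sum theta M.+1.
      by rewrite mulr_sumr; apply: eq_bigr => k _; rewrite scalerAr.
    rewrite E //; apply/expandable_comp/expandableM => //.
    by apply: expandable_sum => k _; apply/expandableZ/expandable_mono_e.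
apply: (@expandable_descent (fun m y => z (e *+ m) * y) theta M b g) => //.
- by rewrite th0.
- by move=> y; rewrite mulr0n mono0 mul1r.
- by move=> m y ey; apply: expandableM => //; apply: expandable_mono_e.
- by move=> m i; exact: comp_monoMl.
move=> i iM; have -> : \sum_(k < M.+1) theta k *: (z (e *+ k) * g) =
    theta_sum theta M.+1 * g.
  by rewrite mulr_suml; apply: eq_bigr => k _; rewrite scalerAl.
rewrite -E //; apply/expandable_comp/expandableM => //.
by apply: expandable_sum => k _; apply/expandableZ/expandable_mono_e.
Qed.

End RankTwo.

(** * Nonnegative weights under conjugation *)

Section Weights.
Variables (R : comNzRingType) (D : seed_data) (X : torus R D).
Variables (S : unitRingType) (iota : {rmorphism R -> S}).
Hypothesis iota_unit : forall a, a != 0 -> iota a \is a GRing.unit.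
Local Notation L := (lattice D).
Variables (d : nat) (e : L) (de : direction d e).
Variables (w : L -> rat) (wD : additive_fun w) (we : 0 <= w e).
Implicit Types (x g h : X).

Definition weight_ge0 x : Prop := forall n, n \in supp x -> 0 <= w n.

Lemma weight_act x n : weight_ge0 x -> w n < 0 ->
  lact iota x (dilog X iota d e 0) n = 0 /\ ract iota (dilog X iota d e 0) x n = 0.
Proof.
move=> xw wn; have out m : m \in supp x -> dilog X iota d e 0 (n - m) = 0.
  move=> /xw wm; have [[k /eqP]|//] := dilogP X iota d e 0 (n - m).
  rewrite subr_eq addrC => /eqP E; move: wn; rewrite E wD (addfMn wD).
  by rewrite ltNge addr_ge0 ?mulrn_wge0.
by split; apply: big1_seq => m /= mx; rewrite out ?mulr0.
Qed.

(** Psi has only weights >= 0. A nonzero part of negative weight on one side would have a lowest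
    term surviving multiplication by Psi, while the other side has no terms of negative weight. *)
Lemma weight_conj g h : dilog_conj iota d e g h -> weight_ge0 g <-> weight_ge0 h.
Proof.
move=> gh; pose P : pred L := fun n => 0 <= w n.
have P_ge0 x : weight_ge0 (proj P x).
  by move=> n; rewrite mem_supp coef_proj; case: ifP => //; rewrite eqxx.
have N_lt0 x n : n \in supp (proj (predC P) x) -> w n < 0.
  by rewrite mem_supp coef_proj /= -ltNge; case: ifP => //; rewrite eqxx.
have P_eq x : proj (predC P) x = 0 -> weight_ge0 x.
  move=> x0 n nx; rewrite leNgt; apply/negP => wn.
  move: nx; rewrite mem_supp; have := congr1 (fun y => coef y n) x0.
  by rewrite coef_proj coef0 /= /P -ltNge wn => ->; rewrite eqxx.
split=> ge0; apply/P_eq/eqP; apply/negP => /negP/(dilog_lead iota de)[n nx [El Er]].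
- have wn := N_lt0 _ _ nx; move: nx; rewrite mem_supp => /negP; apply; apply/eqP/(iota_eq0 iota_unit).
  rewrite -El; have := congr1 (fun f => f n) gh.
  rewrite {1}(proj_split P h) lactD (weight_act (P_ge0 h) wn).1 add0r => ->.
  exact: (weight_act ge0 wn).2.
have wn := N_lt0 _ _ nx; move: nx; rewrite mem_supp => /negP; apply; apply/eqP/(iota_eq0 iota_unit).
rewrite -Er; have := congr1 (fun f => f n) gh.
rewrite {1}(proj_split P g) ractD (weight_act (P_ge0 g) wn).2 add0r => <-.
exact: (weight_act ge0 wn).1.
Qed.

End Weights.

(** * Mutations of seeds *)

(** The invariant carried through mutations: a basis, given by its coordinate functions, and
    integrality against the whole lattice. *)
Record good_seed (D : seed_data) (s : seed D) : Prop := GoodSeed {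
  good_int : forall k n, k \in unfrozen D ->
    (dmul k)%:R * skewform (s k) n \is a Num.int;
  good_dual : exists l : idx D -> lattice D -> int,
    [/\ forall i, additive_fun (l i), forall i j, l i (s j) = (i == j)%:R
      & forall n, n = \sum_i s i *~ l i n]
}.

Section Seeds.
Variable D : seed_data.
Local Notation L := (lattice D).
Local Notation form := (@skewform D).
Implicit Types (s : seed D) (i j k : idx D).

Lemma good_dir s k : good_seed s -> k \in unfrozen D -> direction (dmul k) (s k).
Proof.
move=> gs kuf; split.
- exact: dmul_gt0.
- exact: dmul_qden.
- by move=> n; apply: good_int.
by have [l [lD ls _]] := good_dual gs; exists (l k) => //; rewrite ls eqxx.
Qed.

Lemma good_seed0 : good_seed (@seed0 D).
Proof.
pose a (n : L) := projT1 (cid (seed0_basis n)).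
have aE (n : L) : n = \sum_i seed0 i *~ a n i := (projT2 (cid (seed0_basis n))).1.
have aU (n : L) (b : {ffun idx D -> int}) : n = \sum_i seed0 i *~ b i -> a n = b.
  exact: (projT2 (cid (seed0_basis n))).2.
split=> [k n kuf|].
  rewrite [n]aE form_sumr mulr_sumr rpred_sum // => i _.
  by rewrite formMzr mulrCA rpredM ?intr_int // seed0_int //; left.
exists (fun i n => a n i); split=> [i u v|i j|//].
  have /aU -> : u + v = \sum_i seed0 i *~ [ffun i => a u i + a v i] i.
    rewrite {1}[u]aE {1}[v]aE -big_split; apply: eq_bigr => j _.
    by rewrite ffunE mulrzDr.
  by rewrite ffunE.
have /aU -> : seed0 j = \sum_i seed0 i *~ [ffun i => (i == j)%:R] i.
  rewrite (bigD1 j) //= ffunE eqxx mulr1z big1 ?addr0 // => m /negbTE mj.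
  by rewrite ffunE mj mulr0z.
by rewrite ffunE.
Qed.

Section Mutate.
Variables (s : seed D) (k : idx D).
Hypothesis gs : good_seed s.
Hypothesis kuf : k \in unfrozen D.
Let dk := good_dir gs kuf.
Let b i : int := Num.max 0 (intq (eps s k i)).

Lemma intq_eps i : intq (eps s k i) = - cexp (dmul k) (s k) (s i).
Proof.
apply: (@intr_inj rat); rewrite rmorphN /= (cexpE dk) opprK /intq floorK //.
exact: good_int.
Qed.

Lemma mutate_le0 i : i != k -> form (s k) (s i) <= 0 -> mutate s k i = s i.
Proof.
move=> ik f0; rewrite /mutate (negbTE ik) intq_eps max_l ?mulr0z ?addr0 //.
rewrite oppr_le0 -(ler_int rat) (cexpE dk) oppr_ge0.
by rewrite pmulr_rle0 // ltr0n dmul_gt0.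
Qed.

(** Together with [mutate_le0]: according to the sign of {e_k, e_i}, either the mutated vector is
    e_i itself or [shear] takes it back to e_i. *)
Lemma shear_mutate i : i != k -> 0 <= form (s k) (s i) ->
  shear (dmul k) (s k) (mutate s k i) = s i.
Proof.
move=> ik f0; have c0 := cexp_le0 dk (s i); rewrite f0 in c0.
rewrite /shear /mutate (negbTE ik) intq_eps max_r ?oppr_ge0 //.
rewrite (cexpD dk) (addfMz (cexpD dk)) (cexp_self dk) mul0rz addr0.
by rewrite mulrNz addrNK.
Qed.

Lemma mutate_self : mutate s k k = - s k.
Proof. by rewrite /mutate eqxx. Qed.

Lemma good_mutate : good_seed (mutate s k).
Proof.
split=> [i n iuf|].
  case: (eqVneq i k) => [->|ik].
    by rewrite mutate_self formNl mulrN rpredN good_int.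
  rewrite /mutate (negbTE ik) formDl formMzl mulrDr rpredD ?good_int //.
  have d0 : (dmul k)%:R != 0 :> rat by rewrite pnatr_eq0 -lt0n dmul_gt0.
  have /intrP[c cE] : (dmul i)%:R * form (s i) (s k) \is a Num.int by apply: good_int.
  have epsE : (intq (eps s k i))%:~R = eps s k i :> rat.
    by rewrite /intq floorK // good_int.
  case: (leP 0 (intq (eps s k i))) => _; last by rewrite mul0r mulr0 rpred0.
  (* The d_i of the claim is paired with {e_i, e_k}, and the d_k of epsilon_ki with {e_k, n}; both
     products are integers. *)
  rewrite epsE /eps form_skew; have -> : (dmul i)%:R *
      ((dmul k)%:R * - form (s i) (s k) * form (s k) n) =
      - ((dmul i)%:R * form (s i) (s k)) * ((dmul k)%:R * form (s k) n) by ring.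
  by rewrite rpredM ?rpredN ?good_int.
have [l [lD ls lE]] := good_dual gs.
have lk0 i : i != k -> l i (s k) = 0 by move=> /negbTE ik; rewrite ls ik.
have sE i : i != k -> mutate s k i = s i + s k *~ b i.
  by move=> /negbTE ik; rewrite /mutate ik.
(* Substituting e_i = e_i' - b_i e_k and e_k = -e_k' changes only the coordinate at k. *)
exists (fun i n => if i == k then - l k n + \sum_(j | j != k) b j * l j n else l i n).
split=> [i u v|i j|n].
- case: ifP => _; last exact: lD.
  rewrite lD; under eq_bigr do rewrite lD mulrDr.
  by rewrite big_split opprD addrACA.
- case: (eqVneq i k) => [->|ik]; last first.
    case: (eqVneq j k) => [->|jk].
      by rewrite mutate_self (addfN (lD i)) ls (negbTE ik) oppr0.
    by rewrite sE // lD (addfMz (lD i)) lk0 // mul0rz addr0 ls.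
  case: (eqVneq j k) => [->|jk].
    rewrite mutate_self (addfN (lD k)) opprK ls eqxx big1 ?addr0 // => i' ik'.
    by rewrite (addfN (lD i')) lk0 // oppr0 mulr0.
  rewrite sE // lD (addfMz (lD k)) !ls eqxx [k == j]eq_sym (negbTE jk) add0r.
  rewrite (bigD1 j) //= lD (addfMz (lD j)) lk0 // mul0rz addr0 ls eqxx mulr1.
  rewrite big1 ?addr0 => [|i' /andP[ik' ij']].
    by rewrite intz addNr.
  by rewrite lD (addfMz (lD i')) lk0 // mul0rz addr0 ls (negbTE ij') mulr0.
rewrite {1}[n]lE (bigD1 k) //= [RHS](bigD1 k) //= eqxx mutate_self.
rewrite mulNrz mulrzDr opprD mulrNz opprK -addrA; congr (_ + _).
have -> : s k *~ (\sum_(j | j != k) b j * l j n) = \sum_(j | j != k) s k *~ (b j * l j n).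
  exact: (big_morph (fun c => s k *~ c) (fun c1 c2 => mulrzDr (s k) c1 c2) (mulr0z _)).
rewrite addrC -sumrB; apply: eq_bigr => i ik.
by rewrite (negbTE ik) sE // mulrzDl mulrzA addrK.
Qed.

End Mutate.

(** * Elements that stay Laurent under all mutations *)

Section Expansion.
Variables (R : comNzRingType) (X : torus R D).
Variables (S : unitRingType) (iota : {rmorphism R -> S}).
Hypothesis iota_unit : forall a, a != 0 -> iota a \is a GRing.unit.
Implicit Types g h : X.

(* h is a Laurent polynomial in all the seeds adjacent to s.                  *)
Definition upper_bound s h : Prop :=
  forall k, k \in unfrozen D -> expandable iota (dmul k) (s k) h.

Section Step.
Variables (s : seed D) (k : idx D).
Hypothesis gs : good_seed s.
Hypothesis kuf : k \in unfrozen D.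
Variables g h : X.
Hypothesis gh : dilog_conj iota (dmul k) (s k) g h.
Let dk := good_dir gs kuf.
Let sh := shear (dmul k) (s k).
Let gs' := good_mutate gs kuf.

(** If {e_i, e_k} >= 0, then e_i is unchanged and [expandable_conj] applies directly. Otherwise it
    applies to -e_k through [conj_flip], and [shear] carries the mutated vector to e_i. *)
Lemma expandable_mutate i : i \in unfrozen D -> i != k ->
  expandable iota (dmul i) (s i) h <-> expandable iota (dmul i) (mutate s k i) g.
Proof.
move=> iuf ik; have [l [lD ls _]] := good_dual gs.
have di := good_dir gs iuf; have di' := good_dir gs' iuf.
have lki : l k (s i) = 0 by rewrite ls eq_sym (negbTE ik).
have lkk : l k (s k) = 1 by rewrite ls eqxx.
case: (leP 0 (form (s i) (s k))) => f0.
  rewrite mutate_le0 //; last by rewrite form_skew oppr_le0.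
  exact: (iff_sym (expandable_conj iota_unit dk (lD k) lkk di lki f0 gh)).
have shE : sh (mutate s k i) = s i.
  by apply: shear_mutate; rewrite // form_skew oppr_ge0 ltW.
have gh' := conj_flip iota_unit dk gh.
apply: iff_trans (expandable_conj iota_unit (direction_opp dk) (l := fun n => - l k n)
  _ _ di _ _ gh') _.
- by move=> u v; rewrite lD opprD.
- by rewrite (addfN (lD k)) lkk opprK.
- by rewrite lki oppr0.
- by rewrite formNr oppr_ge0 ltW.
have pushE := conj_push iota (shearD dk) (shear_inj dk) (shear_form dk) (fun r => erefl (qp X r)) di'.
have dsh : direction (dmul i) (sh (mutate s k i)) by rewrite shE.
split=> [[y]|[y yg]]; last first.
  by exists (push X sh y); rewrite -shE; apply/(pushE y g dsh).
have [x ->] := push_surj X (shear_inj dk) (shear_surj dk) y.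
by rewrite -shE => /(pushE x g dsh); exists x.
Qed.

(** Mutating back at k leads to h up to [shear]; the witness is the inverse image of h. *)
Lemma expandable_mutate_self : expandable iota (dmul k) (mutate s k k) g.
Proof.
have gh' := conj_flip iota_unit dk gh.
have pushE := conj_push iota (shearD dk) (shear_inj dk) (shear_form dk) (fun r => erefl (qp X r))
  (direction_opp dk).
have [x xh] := push_surj X (shear_inj dk) (shear_surj dk) h.
have shN : sh (- s k) = - s k by rewrite /sh (addfN (shearD dk)) (shear_self dk).
have dsh : direction (dmul k) (sh (- s k)) by rewrite shN; apply: direction_opp.
by exists x; rewrite mutate_self; apply/(pushE x g dsh); rewrite -xh -/sh shN.
Qed.

Lemma upper_bound_mutate : upper_bound s h <-> upper_bound (mutate s k) g.
Proof.
split=> ub i iuf; case: (eqVneq i k) => [->|ik].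
- exact: expandable_mutate_self.
- by apply/expandable_mutate => //; apply: ub.
- by exists g.
by apply/expandable_mutate => //; apply: ub.
Qed.

Lemma weight_mutate i : i != k ->
  weight_ge0 (form (s i)) h <-> weight_ge0 (form (mutate s k i)) g.
Proof.
move=> ik; have wD : additive_fun (form (s i)) by move=> u v; exact: formDr.
case: (leP 0 (form (s i) (s k))) => f0.
  rewrite mutate_le0 //; last by rewrite form_skew oppr_le0.
  exact: (iff_sym (weight_conj iota_unit dk wD f0 gh)).
have shE : sh (mutate s k i) = s i.
  by apply: shear_mutate; rewrite // form_skew oppr_ge0 ltW.
have gh' := conj_flip iota_unit dk gh.
apply: iff_trans (weight_conj iota_unit (direction_opp dk) wD _ gh') _.
  by rewrite formNr oppr_ge0 ltW.
split=> w n; last first.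
  have [p ->] := shear_surj dk n.
  rewrite mem_supp coef_push -?mem_supp => [pg|]; last exact: shear_inj.
  by rewrite -shE (shear_form dk); apply: w.
move=> ng; rewrite -(shear_form dk) -/sh shE; apply: w.
by rewrite mem_supp coef_push -?mem_supp //; exact: shear_inj.
Qed.

End Step.

Lemma mutate_expand s k g : good_seed s -> k \in unfrozen D ->
  upper_bound (mutate s k) g -> exists h, dilog_conj iota (dmul k) (s k) g h.
Proof.
move=> gs kuf /(_ k kuf)[y]; have dk := good_dir gs kuf.
rewrite mutate_self => /(conj_flip iota_unit (direction_opp dk)).
by rewrite opprK; eexists; eassumption.
Qed.

(* g in the chart of the seed [mutate_along s w] and h in that of s are the   *)
(* same function.                                                             *)
Fixpoint corresp s (w : tree D) g h : Prop :=
  if w is k :: w' then exists2 m, dilog_conj iota (dmul (val k)) (s (val k)) m h &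
    corresp (mutate s (val k)) w' g m
  else g = h.

Lemma good_along s (w : tree D) : good_seed s -> good_seed (mutate_along s w).
Proof.
by elim: w s => //= k w IH s gs; apply/IH/good_mutate => //; exact: valP.
Qed.

Lemma corresp_up s w g : good_seed s -> upper_bound (mutate_along s w) g ->
  exists2 h, corresp s w g h & upper_bound s h.
Proof.
elim: w s => [|k w IH] s gs /= ub; first by exists g.
have kuf := valP k; have [m mg um] := IH _ (good_mutate gs kuf) ub.
have [h mh] := mutate_expand gs kuf um.
by exists h; [exists m|apply/(upper_bound_mutate gs kuf mh)].
Qed.

Lemma corresp_down s w h : good_seed s -> upper_bound s h ->
  exists2 g, corresp s w g h & upper_bound (mutate_along s w) g.
Proof.
elim: w s h => [|k w IH] s h gs ub /=; first by exists h.
have kuf := valP k; have [m mh] := ub _ kuf.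
have [|g gm ug] := IH (mutate s (val k)) m (good_mutate gs kuf).
  exact/(upper_bound_mutate gs kuf mh).
by exists g => //; exists m.
Qed.

(** A frozen i differs from every mutated index, so [weight_mutate] applies along the whole path. *)
Lemma corresp_weight s w g h i : good_seed s -> i \notin unfrozen D -> corresp s w g h ->
  weight_ge0 (form (s i)) h <-> weight_ge0 (form (mutate_along s w i)) g.
Proof.
move=> + iuf; elim: w s h => [|k w IH] s h gs /=; first by move=> ->.
case=> m mh gm; have kuf := valP k; apply: iff_trans (IH _ _ (good_mutate gs kuf) gm).
by apply: (weight_mutate gs kuf mh); apply: contraNneq iuf => ->.
Qed.

Lemma correspM s w g1 h1 g2 h2 : corresp s w g1 h1 -> corresp s w g2 h2 ->
  corresp s w (g1 * g2) (h1 * h2).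
Proof.
elim: w s h1 h2 => [|k w IH] s h1 h2 /=; first by move=> -> ->.
move=> [m1 mh1 gm1] [m2 mh2 gm2]; exists (m1 * m2); first exact: conjM.
exact: IH.
Qed.

Lemma correspD s w g1 h1 g2 h2 : corresp s w g1 h1 -> corresp s w g2 h2 ->
  corresp s w (g1 + g2) (h1 + h2).
Proof.
elim: w s h1 h2 => [|k w IH] s h1 h2 /=; first by move=> -> ->.
move=> [m1 mh1 gm1] [m2 mh2 gm2]; exists (m1 + m2); first exact: conjD.
exact: IH.
Qed.

Lemma correspZ s w c g h : corresp s w g h -> corresp s w (c *: g) (c *: h).
Proof.
elim: w s h => [|k w IH] s h /=; first by move=> ->.
by move=> [m mh gm]; exists (c *: m); [exact: conjZ|exact: IH].
Qed.

Lemma correspB s w g1 h1 g2 h2 : corresp s w g1 h1 -> corresp s w g2 h2 ->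
  corresp s w (g1 - g2) (h1 - h2).
Proof. by move=> c1 c2; rewrite -!scaleN1r; apply/correspD/correspZ. Qed.

(** With [corresp0_eq], this transports vanishing relations from one seed to another through the
    root. *)
Lemma corresp_eq0 s w g : good_seed s -> corresp s w g 0 -> g = 0.
Proof.
elim: w s g => [|k w IH] s g gs //= [m mh].
have kuf := valP k; have dk := good_dir gs kuf.
have -> : m = 0 by apply: (conj_injl iota_unit dk mh); apply: conj0.
exact/IH/good_mutate.
Qed.

Lemma corresp0_eq s w h : good_seed s -> corresp s w 0 h -> h = 0.
Proof.
elim: w s h => [|k w IH] s h gs /= => [<-//|[m mh gm]].
have kuf := valP k; have dk := good_dir gs kuf.
have m0 := IH _ _ (good_mutate gs kuf) gm; apply: (conj_injr iota_unit dk mh).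
by rewrite m0; apply: conj0.
Qed.

End Expansion.
End Seeds.

(** * The reciprocity argument *)

Lemma big_option (V : nmodType) (T : finType) (f : option T -> V) :
  \sum_i f i = f None + \sum_i f (Some i).
Proof.
rewrite -(big_map Some xpredT f) -[RHS](big_cons _ _ None _ xpredT f).
apply: perm_big; apply: uniq_perm; first exact: index_enum_uniq.
  rewrite /= map_inj_uniq ?index_enum_uniq ?andbT; last by move=> ? ? [].
  by apply/mapP => -[].
case=> [i|]; rewrite mem_index_enum inE //=.
by apply/esym/mapP; exists i => //; apply: mem_index_enum.
Qed.

(** * Adjoining a frozen vector dual to a coordinate *)

Section Extension.
Variables (D : seed_data) (l : lattice D -> int).
Hypothesis lD : additive_fun l.
Local Notation L := (lattice D).
Local Notation E := (L * int)%type.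

Definition ext_form (u v : E) : rat :=
  skewform u.1 v.1 + (l u.1 * v.2 - u.2 * l v.1)%:~R.

Lemma ext_formDl u v w : ext_form (u + v) w = ext_form u w + ext_form v w.
Proof.
rewrite /ext_form /= formDl lD addrACA -intrD; congr (_ + _%:~R); ring.
Qed.

Lemma ext_form_skew u v : ext_form u v = - ext_form v u.
Proof. by rewrite /ext_form form_skew opprD -mulrNz; congr (_ + _%:~R); ring. Qed.

Definition ext_dmul (i : option (idx D)) : nat := if i is Some i then dmul i else 1.

Lemma ext_dmul_gt0 i : (0 < ext_dmul i)%N.
Proof. by case: i => //= i; apply: dmul_gt0. Qed.

Lemma ext_dmul_gcd : \big[gcdn/0%N]_i ext_dmul i = 1%N.
Proof. by rewrite (bigD1 None) //= gcd1n. Qed.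

Definition ext_seed0 (i : option (idx D)) : E := if i is Some i then (seed0 i, 0) else (0, 1).

Lemma ext_sum (b : option (idx D) -> int) :
  \sum_i ext_seed0 i *~ b i = (\sum_i seed0 i *~ b (Some i), b None).
Proof.
have D1 : additive_fun (fst : E -> L) by [].
have D2 : additive_fun (snd : E -> int) by [].
rewrite big_option [LHS]surjective_pairing /=; congr (_, _).
  rewrite (addfMz D1) mul0rz add0r.
  rewrite (big_morph (fst : E -> L) D1 (erefl _)).
  by apply: eq_bigr => i _; rewrite (addfMz D1).
rewrite (addfMz D2) /= intz (big_morph (snd : E -> int) D2 (erefl _)) big1 ?addr0 // => i _.
by rewrite (addfMz D2) mul0rz.
Qed.

Lemma ext_seed0_basis v :
  exists! a : {ffun option (idx D) -> int}, v = \sum_i ext_seed0 i *~ a i.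
Proof.
have [a [aE aU]] := seed0_basis v.1.
exists [ffun i => if i is Some i then a i else v.2]; split=> [|b].
  rewrite ext_sum ffunE [LHS]surjective_pairing; congr (_, _).
  by rewrite {1}aE; apply: eq_bigr => i _; rewrite ffunE.
rewrite ext_sum => /[dup] /(congr1 snd) /= v2 /(congr1 fst) /= v1.
apply/ffunP => -[i|]; rewrite ffunE ?v2 //.
have -> : a = [ffun i => b (Some i)].
  by apply: aU; rewrite v1; apply: eq_bigr => j _; rewrite ffunE.
by rewrite ffunE.
Qed.

Lemma ext_seed0_int i j :
  i \in [set Some k | k in unfrozen D] \/ j \in [set Some k | k in unfrozen D] ->
  (ext_dmul i)%:R * ext_form (ext_seed0 i) (ext_seed0 j) \is a Num.int.
Proof.
case: i j => [i|] [j|] ij; rewrite /ext_form /=.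
- rewrite !mulr0 !mul0r subrr addr0 seed0_int //.
  by case: ij => /imsetP[k kuf [->]]; [left|right].
- by rewrite form0r add0r rpredM ?natr_int ?intr_int.
- by rewrite form0l add0r rpredM ?natr_int ?intr_int.
by rewrite form0l add0r rpredM ?natr_int ?intr_int.
Qed.

Lemma ext_dmul_qden i : (ext_dmul i %| qden D)%N.
Proof. by case: i => //= i; apply: dmul_qden. Qed.

Lemma ext_form_qden u v : (qden D)%:R * ext_form u v \is a Num.int.
Proof. by rewrite /ext_form mulrDr rpredD ?form_qden // rpredM ?natr_int ?intr_int. Qed.

(* N + Z a with {n, a} = l(n).                                                *)
Definition extension : seed_data :=
  @SeedData E ext_form ext_formDl ext_form_skew (option (idx D))
    [set Some k | k in unfrozen D] ext_dmul ext_dmul_gt0 ext_dmul_gcd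
    ext_seed0 ext_seed0_basis ext_seed0_int (qden D) (qden_gt0 D)
    ext_dmul_qden ext_form_qden.

Definition embed (n : L) : lattice extension := (n, 0).

Lemma embedD : additive_fun embed.
Proof. by move=> u v; rewrite /embed; congr (_, _); rewrite addr0. Qed.

Lemma embed_inj : injective embed.
Proof. by move=> u v []. Qed.

Lemma embed_form u v : skewform (embed u) (embed v) = skewform u v.
Proof. by rewrite /= /ext_form /= mulr0 mul0r subrr addr0. Qed.

Definition lift_tree (w : tree D) : tree extension :=
  [seq exist (fun k : idx extension => k \in unfrozen extension)
     (Some (val k)) (imset_f Some (valP k)) | k <- w].

(** Nothing is asked at [None]: this index is frozen, so its vector never enters the mutated vectors
    at the old indices. *)
Definition lifts (s : seed D) (s' : seed extension) : Prop :=
  forall i, s' (Some i) = embed (s i).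

Lemma lifts_seed0 : lifts (@seed0 D) (@seed0 extension).
Proof. by []. Qed.

Lemma lifts_mutate s s' k : lifts s s' -> lifts (mutate s k) (mutate s' (Some k)).
Proof.
move=> ss i; rewrite /mutate; have -> : (Some i == Some k) = (i == k) by [].
case: eqP => _; first by rewrite ss -(addfN embedD).
rewrite !ss /eps !ss embed_form -(addfMz embedD) -embedD.
by [].
Qed.

Lemma lifts_along s s' w : lifts s s' ->
  lifts (mutate_along s w) (mutate_along s' (lift_tree w)).
Proof. by elim: w s s' => //= k w IH s s' ss; apply/IH/lifts_mutate. Qed.

Section CorrespLift.
Variables (R : comNzRingType) (X : torus R D) (Y : torus R extension).
Hypothesis qpXY : forall r, qp X r = qp Y r.
Variables (S : unitRingType) (iota : {rmorphism R -> S}).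

Lemma corresp_lift s s' w (g h : X) : good_seed s -> good_seed s' -> lifts s s' ->
  corresp iota s w g h ->
  corresp iota s' (lift_tree w) (push Y embed g) (push Y embed h).
Proof.
elim: w s s' h => [|k w IH] s s' h gs gs' ss /=; first by move->.
case=> m mh gm; have kuf := valP k.
have kuf' : Some (val k) \in unfrozen extension by rewrite imset_f.
exists (push Y embed m); last first.
  by apply: IH gm; [apply: good_mutate|apply: good_mutate|apply: lifts_mutate].
have := good_dir gs' kuf'; rewrite ss => dk'.
by apply/(conj_push iota embedD embed_inj embed_form qpXY (good_dir gs kuf) m h dk').
Qed.

End CorrespLift.

End Extension.

(** * Lowest components along a grading *)

Section Lowest.
Variables (R : comNzRingType) (D : seed_data) (X : torus R D).
Variables (l : lattice D -> int) (lD : additive_fun l).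
Implicit Types (x y : X) (a b : int).
Local Notation comp i := (@proj R D X (fun n : lattice D => l n == i)).

Definition low b x : Prop := forall n, n \in supp x -> b <= l n.

Lemma coefM_on (w : seq (lattice D)) x y n : uniq w -> {subset supp x <= w} ->
  coef (x * y) n = \sum_(m <- w) coef x m * (qp X (- skewform m n) * coef y (n - m)).
Proof. by move=> uw xw; rewrite coefMl -(big_supp uw xw) // => m ->; rewrite mul0r. Qed.

Lemma lowM a b x y : low a x -> low b y -> low (a + b) (x * y).
Proof.
move=> xa yb n; rewrite mem_supp leNgt; apply: contraNN => ln; apply/eqP.
rewrite coefMl big1_seq // => m /= /xa am.
rewrite [coef y _]supp_nil ?mulr0 //; apply/negP => /yb.
by rewrite (addfB lD); lia.
Qed.

Lemma comp_lowM a b x y : low a x -> low b y -> comp (a + b) (x * y) = comp a x * comp b y.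
Proof.
move=> xa yb; apply: torusP => n; rewrite coef_proj.
rewrite [RHS](coefM_on _ _ (supp_uniq x)) => [|m]; last first.
  by rewrite !mem_supp coef_proj; case: ifP; rewrite ?eqxx.
rewrite coefMl; case: eqP => ln; last first.
  rewrite big1_seq // => m /= _; rewrite !coef_proj.
  case: eqP => lm; last by rewrite mul0r.
  case: eqP => lnm; last by rewrite !mulr0.
  by case: ln; rewrite -lm -lnm (addfB lD); lia.
apply: eq_big_seq => m mx; rewrite !coef_proj.
case ny: (n - m \in supp y); last by rewrite [coef y _]supp_nil ?ny // if_same !mulr0.
have := xa m mx; have := yb _ ny; rewrite (addfB lD) => bm am.
by rewrite ifT ?ifT //; apply/eqP; lia.
Qed.

Lemma lowD a x y : low a x -> low a y -> low a (x + y).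
Proof.
move=> xa ya n; rewrite mem_supp coefD => xy.
case nx: (n \in supp x); first exact: xa.
apply: ya; rewrite mem_supp; apply: contraNneq xy => ->.
by rewrite supp_nil ?nx // addr0.
Qed.

Lemma lowZ a c x : low a x -> low a (c *: x).
Proof.
move=> xa n; rewrite mem_supp coefZ => cx; apply: xa; rewrite mem_supp.
by apply: contraNneq cx => ->; rewrite mulr0.
Qed.

Lemma low_exists x : x != 0 -> exists2 b, low b x & comp b x != 0.
Proof.
move=> x0; have [n0 n0x] := torus_neq0 x0; have [b xb] := supp_bound l x.
have [k [n [nx nk] kmin]] : exists2 k : nat, exists2 n, n \in supp x & l n = b + k%:Z &
    forall m, m \in supp x -> b + k%:Z <= l m.
  have ex : exists k : nat, has (fun n => l n == b + k%:Z) (supp x).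
    exists (absz (l n0 - b)); apply/hasP; exists n0 => //; apply/eqP.
    by have := xb _ n0x; lia.
  exists (ex_minn ex); case: ex_minnP => k /hasP[n nx /eqP nk] kmin; first by exists n.
  move=> m mx; have := xb m mx => bm.
  have /kmin : has (fun n => l n == b + (absz (l m - b))%:Z) (supp x).
    by apply/hasP; exists m => //; apply/eqP; lia.
  by lia.
exists (b + k%:Z); first exact: kmin.
apply: contraTneq nx => c0; have := congr1 (fun y => coef y n) c0.
by rewrite mem_supp coef_proj coef0 nk eqxx => ->; rewrite eqxx.
Qed.

End Lowest.

(** * Iterated q-commutators *)

Section IteratedCommutator.
Variables (R : comNzRingType) (D : seed_data) (X : torus R D).
Implicit Types (x y : X) (qs : seq R).

Fixpoint qcomm x qs y : X :=
  if qs is c :: qs' then x * qcomm x qs' y - c *: (qcomm x qs' y * x) else y.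

Lemma qcommD x qs y1 y2 : qcomm x qs (y1 + y2) = qcomm x qs y1 + qcomm x qs y2.
Proof.
by elim: qs => //= c qs ->; rewrite mulrDl mulrDr scalerDr opprD addrACA.
Qed.

Lemma qcommZ x qs b y : qcomm x qs (b *: y) = b *: qcomm x qs y.
Proof.
elim: qs => //= c qs ->; rewrite -scalerAl -scalerAr scalerBr !scalerA.
by rewrite [c * b]mulrC.
Qed.

Lemma qcomm0 x qs : qcomm x qs 0 = 0.
Proof. by rewrite -(scale0r (0 : X)) qcommZ !scale0r. Qed.

(** Each step turns y x^j into x y x^j - c y x^(j+1) = (b - c) y x^(j+1); so the result vanishes
    once b is among the weights. *)
Lemma qcomm_eigen x qs b y : x * y = b *: (y * x) ->
  qcomm x qs y = (\prod_(c <- qs) (b - c)) *: (y * x ^+ size qs).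
Proof.
move=> xy; elim: qs => [|c qs /= ->]; first by rewrite big_nil scale1r mulr1.
rewrite big_cons -scalerAr mulrA xy -!scalerAl -!mulrA -exprS -exprSr !scalerA.
by rewrite -scalerBl; congr (_ *: _); ring.
Qed.

Lemma qcomm_corresp (S : unitRingType) (iota : {rmorphism R -> S}) s w x x0 y y0 qs :
  corresp iota s w x x0 -> corresp iota s w y y0 ->
  corresp iota s w (qcomm x qs y) (qcomm x0 qs y0).
Proof.
move=> cx cy; elim: qs => //= c qs IH.
by apply: correspB; [|apply: correspZ]; apply: correspM.
Qed.

Lemma qcomm_low (l : lattice D -> int) (lD : additive_fun l) r x y b qs :
  low l r x -> low l 0 y -> proj (fun n => l n == 0) y = y ->
  proj (fun n => l n == r) x * y = b *: (y * proj (fun n => l n == r) x) ->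
  low l (r *+ size qs) (qcomm x qs y) /\
  proj (fun n => l n == r *+ size qs) (qcomm x qs y) =
    (\prod_(c <- qs) (b - c)) *: (y * proj (fun n => l n == r) x ^+ size qs).
Proof.
move=> lx ly yy; set x0 := proj _ x => xy.
elim: qs => [|c qs [lIH IH]] /=; first by rewrite mulr0n yy big_nil scale1r mulr1.
have l1 := lowM lD lx lIH; have l2 := lowM lD lIH lx.
have c1 := comp_lowM lD lx lIH; have c2 := comp_lowM lD lIH lx.
rewrite -mulrS in l1 c1; rewrite -mulrSr in l2 c2.
split; first by rewrite -scaleNr; apply: lowD; last exact: lowZ.
rewrite -scaleNr projD projZ c1 c2 IH -/x0 big_cons.
rewrite -scalerAr mulrA xy -!scalerAl -!mulrA -exprS -exprSr !scalerA.
by rewrite -scalerDl; congr (_ *: _); ring.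
Qed.

End IteratedCommutator.

Section Reciprocity.
Variables (D : seed_data) (l : lattice D -> int) (lD : additive_fun l).
Local Notation E := (extension lD).
Variables (R : comNzRingType) (X : torus R D) (Y : torus R E).
Hypothesis qpXY : forall r, qp X r = qp Y r.
Hypothesis X_domain : forall x y : X, x != 0 -> y != 0 -> x * y != 0.
Variables (S : unitRingType) (iota : {rmorphism R -> S}).
Hypothesis iota_unit : forall a, a != 0 -> iota a \is a GRing.unit.
Variables (t t' : tree D) (a : idx D -> nat) (v : lattice D) (h0 h : X).
Hypothesis v_def : v = \sum_(i | i \notin unfrozen D) seed_at t i *+ a i.
Hypothesis l_ge0 : forall i, 0 <= l (seed_at t' i).
Hypothesis vh0 : corresp iota (@seed0 D) t (mono X v) h0.
Hypothesis hh0 : corresp iota (@seed0 D) t' h h0.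

Let alpha : lattice E := (0, 1).
Let A := mono Y alpha.
Local Notation emb := (@embed D l lD).
Local Notation em := (push Y emb).

Let form_alpha (n : lattice E) : skewform n alpha = (l n.1)%:~R.
Proof. by rewrite /= /ext_form /= form0r add0r (addf0 lD) mulr0 subr0 mulr1. Qed.

Let le (n : lattice E) : int := l n.1.

Let leD : additive_fun le.
Proof. by move=> u w; rewrite /le lD. Qed.

(** At t' every {e_i, alpha} = l(e_i) is >= 0. For unfrozen i this makes z^alpha Laurent in all
    seeds; for frozen i it is a weight condition that persists to t, where v is a nonnegative
    combination of frozen vectors. *)
Lemma weights_ge0 : exists2 B, exists2 B0, corresp iota (@seed0 E) (lift_tree lD t') A B0 &
  corresp iota (@seed0 E) (lift_tree lD t) B B0 &
  forall n, n \in supp B -> 0 <= skewform (emb v) n.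
Proof.
have gE := good_seed0 E.
have lift_t := lifts_along t (lifts_seed0 lD); have lift_t' := lifts_along t' (lifts_seed0 lD).
have ubA : upper_bound iota (mutate_along (@seed0 E) (lift_tree lD t')) A.
  move=> k kuf; apply: expandable_mono => //; first exact: good_dir (good_along _ gE) kuf.
  case/imsetP: (kuf) => i iuf ->; rewrite lift_t' form_alpha ler0z.
  exact: l_ge0.
have [B0 AB0 ub0] := corresp_up iota_unit gE ubA.
have [B BB0 _] := corresp_down iota_unit (lift_tree lD t) gE ub0.
exists B; first by exists B0.
move=> n nB; rewrite v_def.
have -> : emb (\sum_(i | i \notin unfrozen D) seed_at t i *+ a i) =
    \sum_(i | i \notin unfrozen D) emb (seed_at t i) *+ a i.
  rewrite (big_morph emb (embedD lD) (addf0 (embedD lD))).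
  by apply: eq_bigr => i _; rewrite (addfMn (embedD lD)).
rewrite form_suml sumr_ge0 // => i iuf; rewrite formMnl mulr_ge0 //.
have iuf' : Some i \notin unfrozen E.
  by apply: contra iuf => /imsetP[j juf [->]].
rewrite -lift_t; apply: (corresp_weight iota_unit gE iuf' BB0).1 n nB.
apply/(corresp_weight iota_unit gE iuf' AB0) => p; rewrite lift_t'.
move=> /(supp_mono (X := Y)); rewrite inE => /eqP ->.
by rewrite form_alpha ler0z; apply: l_ge0.
Qed.

(* B is killed by a product of q-commutators with z^v whose weights are >= 0; *)
(* read at t', where B is z^alpha, these weights bound below the exponents    *)
(* of h along l.                                                              *)
Lemma reciprocity n : n \in supp h -> 0 <= l n.
Proof.
move=> nh; have [B [B0 AB0 BB0] B_ge0] := weights_ge0.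
have gE := good_seed0 E; have gD := good_seed0 D.
have lift0 := lifts_seed0 lD.
have vh0' := corresp_lift qpXY gD gE lift0 vh0.
have hh0' := corresp_lift qpXY gD gE lift0 hh0.
pose weight p := qp Y (- (skewform (emb v) p *+ 2)).
pose qs := [seq weight p | p <- supp B].
have em_v : em (mono X v) = mono Y (emb v) by apply: push_mono; apply: embed_inj.
(* Each monomial z^p of B q-commutes with z^v, and the list contains its own weight. *)
have kill : qcomm (em (mono X v)) qs B = 0.
  rewrite [Z in qcomm _ _ Z]torus_sum (big_morph _ (qcommD _ _) (qcomm0 _ _)).
  rewrite big1_seq // => p /= pB; rewrite qcommZ em_v.
  rewrite (qcomm_eigen _ (mono_comm Y (emb v) p)).
  rewrite (big_rem (weight p)) /=; last exact: map_f.
  by rewrite /weight subrr mul0r scale0r scaler0.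
have killA : qcomm (em h) qs A = 0.
  apply: (corresp_eq0 iota_unit gE (w := lift_tree lD t')).
  rewrite -(corresp0_eq iota_unit gE (w := lift_tree lD t) (h := qcomm (em h0) qs B0)).
    exact: qcomm_corresp.
  by rewrite -kill; apply: qcomm_corresp.
have h_neq0 : h != 0.
  by apply: contraTneq nh => ->; rewrite mem_supp coef0 eqxx.
have [r lowh hr] := low_exists l h_neq0.
apply: le_trans (lowh n nh); rewrite leNgt; apply/negP => r0.
set hr0 := proj _ h in hr.
have em_low : low le r (em h).
  move=> p; rewrite mem_supp; have [[m ->]|out] := push_imageP emb p.
    by rewrite coef_push ?embed_inj // -?mem_supp //; [apply: lowh|apply: embed_inj].
  by rewrite coef_push_out ?eqxx.
have em_proj : proj (fun p => le p == r) (em h) = em hr0.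
  apply: torusP => p; rewrite coef_proj; have [[m ->]|out] := push_imageP emb p.
    by rewrite !coef_push ?coef_proj //; apply: embed_inj.
  by rewrite !coef_push_out ?if_same.
have lowA : low le 0 A.
  by move=> p /(supp_mono (X := Y)); rewrite inE => /eqP ->; rewrite /le (addf0 lD).
have projA : proj (fun p => le p == 0) A = A.
  apply: torusP => p; rewrite coef_proj coef_mono; case: (eqVneq alpha p) => [<-|_].
    by rewrite /le (addf0 lD).
  by rewrite if_same.
pose q0 := qp Y (- (r%:~R *+ 2)).
have commA : em hr0 * A = q0 *: (A * em hr0).
  rewrite -em_proj [proj _ _]torus_sum mulr_suml mulr_sumr scaler_sumr.
  apply: eq_big_seq => p; rewrite mem_supp coef_proj; case: (le p =P r) => [lp _|_]; last by rewrite eqxx.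
  rewrite -scalerAl -scalerAr mono_comm form_alpha -/(le p) lp.
  by rewrite scalerA [RHS]scalerA mulrC.
have [|_] := qcomm_low leD (b := q0) qs em_low lowA projA.
  by rewrite em_proj.
rewrite killA proj0 em_proj; apply/eqP; rewrite eq_sym.
(* A vanishing factor would mean r = {v, p} for some exponent p of B, contradicting r < 0. *)
have kappa0 : \prod_(c <- qs) (q0 - c) != 0.
  rewrite /qs big_map big_seq; elim/big_rec: _ => [|p x pB x0]; first exact: oner_neq0.
  apply: (iota_neq0M iota_unit) x0.
  rewrite subr_eq0; apply/eqP => q0E.
  have rZ : qint E r%:~R by rewrite /qint rpredM ?natr_int ?intr_int.
  have w0 := B_ge0 p pB.
  have : qp Y (skewform (emb v) p *+ 2 - r%:~R *+ 2) = 1.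
    rewrite -qpM; last by rewrite mulr2n; apply: qintD; apply: qint_form.
    rewrite -/q0 q0E /weight qpMN // mulr2n; apply: qintD; exact: qint_form.
  move/qp_neq1 => /(_ _)/eqP; rewrite subr_eq0 => F.
  have : skewform (emb v) p *+ 2 == r%:~R *+ 2.
    apply: F; apply: qintD; last apply: qintN; rewrite mulr2n; apply: qintD => //; exact: qint_form.
  rewrite eqrMn2r // => /eqP wr; move: w0; rewrite wr ler0z.
  by rewrite leNgt r0.
have emX k : em hr0 ^+ k = em (hr0 ^+ k).
  elim: k => [|k IH]; first by rewrite !expr0 (push1 X Y (embedD lD) (@embed_inj _ _ lD)).
  by rewrite !exprS IH (pushM (embedD lD) (@embed_inj _ _ lD) (embed_form lD) qpXY).
have hX k : hr0 ^+ k != 0.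
  elim: k => [|k IH]; last by rewrite exprS; apply: X_domain.
  rewrite expr0 -(mono0 X); apply: contraTneq (oner_neq0 R) => /(congr1 (fun y => coef y 0)).
  by rewrite coef_mono eqxx coef0 => /eqP; rewrite negbK.
rewrite emX; have [m mh] := torus_neq0 (hX (size qs)).
(* Left multiplication by z^alpha shifts exponents by alpha, so the nonzero coefficient at m is
   found here. *)
apply/eqP => /(congr1 (fun y => coef y (emb m + alpha))).
rewrite coef0 coefZ coef_monoMl addrK coef_push; last exact: embed_inj.
apply/eqP; apply: (iota_neq0M iota_unit) => //.
rewrite mem_supp in mh; apply: contraNneq mh => /qp_unit -> //.
by apply: qintN; apply: qint_form.
Qed.

End Reciprocity.

(** * Pullbacks in the skew field of fractions *)

Section Fractions.
Variables (R : comNzRingType) (D : seed_data) (X : torus R D).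
Variables (F : unitRingType) (inj : {rmorphism X -> F}).
Hypothesis inj_unit : forall x, x != 0 -> inj x \is a GRing.unit.
Local Notation z := (@mono R D X).

(** The skew field itself plays the role of S: nonzero scalars, in particular the q_k^(2m) - 1, are
    invertible in it. *)
Definition scalar_inj : {rmorphism R -> F} := inj \o in_alg X.
Local Notation iota := scalar_inj.

Lemma coef_one : coef (1 : X) 0 = 1.
Proof. by rewrite -mono0 coef_mono eqxx. Qed.

Lemma scalar_inj_unit c : c != 0 -> iota c \is a GRing.unit.
Proof.
move=> c0; apply: inj_unit; apply: contraNneq c0 => /(congr1 (fun x : X => coef x 0)).
by rewrite coefZ coef0 coef_one mulr1 => ->.
Qed.

Lemma inj_eq0 x : inj x = 0 -> x = 0.
Proof. by move=> x0; apply/eqP/negP => /negP/inj_unit; rewrite x0 unitr0. Qed.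

Lemma torus_domain (x y : X) : x != 0 -> y != 0 -> x * y != 0.
Proof.
move=> /inj_unit ux /inj_unit uy; apply/eqP => /(congr1 inj).
rewrite rmorphM rmorph0 => E.
by move: uy; rewrite -[inj y](mulKr ux) E mulr0 unitr0.
Qed.

Variables (d : nat) (e : lattice D).
Hypothesis de : direction d e.
Local Notation factor a := (dfactor X d e a).
Local Notation conj := (@dilog_conj R D X F iota d e).

Definition conj_monomial (n : lattice D) : F :=
  if 0 <= cexp d e n then
    inj (z n) * \prod_(1 <= r < `|cexp d e n|%N.+1) inj (factor (2 * r%:R - 1))
  else
    inj (z n) * \prod_(1 <= r < `|cexp d e n|%N.+1) (inj (factor (- (2 * r%:R - 1))))^-1.

Definition conj_torus (x : X) : F :=
  \sum_(n <- supp x) inj (coef x n *: 1) * conj_monomial n.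

Lemma conj_dfactors (I : Type) (r : seq I) (f : I -> rat) :
  conj (\prod_(i <- r) factor (f i)) (\prod_(i <- r) factor (f i)).
Proof.
elim: r => [|i r IH]; first by rewrite !big_nil; apply: conj1.
by rewrite !big_cons; apply: conjM => //; apply: dfactor_commute.
Qed.

Lemma dfactor_neq0 a : factor a != 0.
Proof.
have [l lD le] := dir_lam de; have e0 : e != 0.
  by apply: contraTneq (oner_neq0 int) => E; rewrite -le E (addf0 lD) eqxx.
apply: contraTneq (oner_neq0 R) => /(congr1 (fun x : X => coef x 0)).
rewrite coefD coefZ coef0 coef_one coef_mono (negbTE e0) mulr0 addr0.
by move=> ->; rewrite eqxx.
Qed.

Lemma prod_dfactor_neq0 (I : Type) (r : seq I) (f : I -> rat) :
  \prod_(i <- r) factor (f i) != 0.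
Proof.
elim: r => [|i r IH].
  by rewrite big_nil; apply: contraTneq (oner_neq0 R) => E; rewrite -coef_one E coef0 eqxx.
by rewrite big_cons; apply: torus_domain => //; apply: dfactor_neq0.
Qed.

Lemma prod_inv_dfactor m :
  \prod_(1 <= r < m.+1) (inj (factor (- (2 * r%:R - 1))))^-1 *
  inj (dprod_neg X d e m) = 1.
Proof.
elim: m => [|m IH]; first by rewrite /dprod_neg !big_geq // mul1r rmorph1.
rewrite big_nat_recr //= dprod_negS.
have -> : 2 * m.+1%:R - 1 = 2 * m%:R + 1 :> rat by rewrite -natr1; ring.
have -> : dprod_neg X d e m * factor (- (2 * m%:R + 1)) =
    factor (- (2 * m%:R + 1)) * dprod_neg X d e m.
  by apply/commr_sym/commr_prod => i _; apply: dfactor_comm.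
rewrite rmorphM -mulrA mulKr; first exact: IH.
exact/inj_unit/dfactor_neq0.
Qed.

(** [dprod_neg] commutes with Psi and, for N large, contains the denominator of the image of z^n;
    this compares the closed formula in F with [dilog_conj]. *)
Lemma conj_monomial_denominator n N : (`|cexp d e n| <= N)%N ->
  exists2 x : X, conj_monomial n * inj (dprod_neg X d e N) = inj x &
    conj (z n * dprod_neg X d e N) x.
Proof.
move=> cN; rewrite /conj_monomial.
case: (leP 0 (cexp d e n)) => c0.
  exists (z n * dprod_pos X d e `|cexp d e n| * dprod_neg X d e N).
    by rewrite !rmorphM /dprod_pos [in RHS]rmorph_prod.
  apply: conjM; first exact: (conj_pos X scalar_inj_unit de c0).
  exact: conj_dfactors.
pose Q := \prod_(`|cexp d e n|.+1 <= r < N.+1) factor (- (2 * r%:R - 1)).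
have QE : dprod_neg X d e N = dprod_neg X d e `|cexp d e n| * Q.
  by rewrite /dprod_neg (big_cat_nat _ (n := `|cexp d e n|.+1)).
exists (z n * Q).
  by rewrite QE !rmorphM mulrA -[Z in Z * _]mulrA prod_inv_dfactor mulr1.
rewrite QE mulrA; apply: conjM; last exact: conj_dfactors.
exact: (conj_neg X scalar_inj_unit de (ltW c0)).
Qed.

Lemma conj_torus_denominator (b : X) N :
  (forall n, n \in supp b -> (`|cexp d e n| <= N)%N) ->
  exists2 x : X, conj_torus b * inj (dprod_neg X d e N) = inj x &
    conj (b * dprod_neg X d e N) x.
Proof.
rewrite /conj_torus [Z in conj (Z * _)]torus_sum !mulr_suml.
elim: (supp b) => [|n r IH] bN.
  by exists 0; rewrite !big_nil ?rmorph0 //; apply: conj0.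
have [|x1 E1 c1] := @conj_monomial_denominator n N; first by apply: bN; rewrite mem_head.
have [|x2 E2 c2] := IH; first by move=> m mr; apply: bN; rewrite inE mr orbT.
exists (coef b n *: x1 + x2); rewrite !big_cons; last first.
  by apply: conjD => //; rewrite -scalerAl; apply: conjZ.
rewrite E2 -mulrA E1 rmorphD; congr (_ + _).
by rewrite -rmorphM -scalerAl mul1r.
Qed.

(** The pullback chooses some fraction a / b for g, so the result must not depend on it. With a
    common denominator Q, a Q and b Q are conjugated to Laurent polynomials xa and xb, and a = g b
    gives xa = h xb. *)
Lemma conj_torus_frac (g h a b : X) : conj g h -> b != 0 ->
  inj g = inj a / inj b -> conj_torus a / conj_torus b = inj h.
Proof.
move=> gh b0 gE; have aE : a = g * b.
  apply/eqP; rewrite -subr_eq0; apply/eqP/inj_eq0.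
  by rewrite rmorphB rmorphM gE divrK ?subrr // inj_unit.
pose N := (\max_(n <- supp a ++ supp b) `|cexp d e n|)%N.
have leN n : n \in supp a ++ supp b -> (`|cexp d e n| <= N)%N.
  by move=> nab; rewrite /N (big_rem n) //= leq_maxl.
have [|xa Ea ca] := @conj_torus_denominator a N.
  by move=> n na; apply: leN; rewrite mem_cat na.
have [|xb Eb cb] := @conj_torus_denominator b N.
  by move=> n na; apply: leN; rewrite mem_cat na orbT.
set Q := dprod_neg X d e N in Ea Eb ca cb.
have Q0 : Q != 0 by apply: prod_dfactor_neq0.
have xaE : xa = h * xb.
  by apply: (conj_injr scalar_inj_unit de ca); rewrite aE -mulrA; apply: conjM.
have -> : conj_torus a = inj h * conj_torus b.
  by apply: (mulIr (inj_unit Q0)); rewrite Ea xaE -mulrA Eb rmorphM.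
rewrite mulrK //; have bQ := torus_domain b0 Q0.
have xb0 : xb != 0.
  apply: contraNneq bQ => xb0; apply/eqP/(conj_injl scalar_inj_unit de cb).
  by rewrite xb0; apply: conj0.
have -> : conj_torus b = inj xb / inj Q by rewrite -Eb mulrK ?inj_unit.
by rewrite unitrMl ?unitrV inj_unit.
Qed.

End Fractions.

Section SkewFractions.
Variables (K : fieldType) (D : seed_data) (F : skew_fractions (qtorus K D)).
Local Notation X := (qtor K D).

Lemma skew_inj_unit (x : qtorus K D) : x != 0 -> skew_inj F x \is a GRing.unit.
Proof.
move=> x0; apply: skew_unit; apply: contraNneq x0 => E.
by apply/eqP/(@skew_injP _ F); rewrite E rmorph0.
Qed.

Definition frac_inj : {rmorphism X -> F} := skew_inj F.

Lemma mut_pullback_inj (s : seed D) (k : idx D) (g h : X) :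
  direction (dmul k) (s k) ->
  dilog_conj (scalar_inj frac_inj) (dmul k) (s k) g h ->
  mut_pullback s k (frac_inj g) = frac_inj h.
Proof.
move=> dk gh; rewrite /mut_pullback.
have := xchooseP (skew_frac (frac_inj g)); rewrite -/(fraction_of (frac_inj g)).
case: (fraction_of (frac_inj g)) => a b /= /andP[b0 /eqP gE].
(* For the torus [qtor K D], [mut_torus] and [conj_torus] agree by unfolding. *)
exact: (conj_torus_frac (X := X) (inj := frac_inj) skew_inj_unit dk gh b0 gE).
Qed.

Lemma pullback_corresp (s : seed D) (w : tree D) (g h : X) : good_seed s ->
  corresp (scalar_inj frac_inj) s w g h ->
  pullback_along s w (frac_inj g) = frac_inj h.
Proof.
elim: w s h => [|k w IH] s h gs /=; first by move->.
case=> m mh gm; have kuf := valP k.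
rewrite (IH _ _ (good_mutate gs kuf) gm).
exact: mut_pullback_inj (good_dir gs kuf) mh.
Qed.

End SkewFractions.

Theorem proposition4p2 (K : fieldType) (charK : [pchar K] =i pred0)
    (D : seed_data) (F : skew_fractions (qtorus K D))
    (t : tree D) (a : idx D -> nat) (v : lattice D)
    (v_def : v = \sum_(i | i \notin unfrozen D) seed_at t i *+ a i)
    (v_ge0 : forall j, j \in unfrozen D -> 0 <= skewform (seed_at t j) v)
    (t' : tree D) :
  polynomial_in F t (zpow K v) t'.
Proof.
pose X := qtor K D; have g0 := good_seed0 D.
have ju : forall x : X, x != 0 -> frac_inj F x \is a GRing.unit := @skew_inj_unit K D F.
have iu := scalar_inj_unit ju.
have ub : upper_bound (scalar_inj (frac_inj F)) (seed_at t) (mono X v).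
  move=> k kuf; have dk := good_dir (good_along t g0) kuf.
  exact: (expandable_mono X iu dk (v_ge0 k kuf)).
have [h0 vh0 ub0] := corresp_up iu g0 ub.
have [h hh0 _] := corresp_down iu t' g0 ub0.
exists h; last first.
  have E1 := pullback_corresp g0 vh0; have E2 := pullback_corresp g0 hh0.
  exact: etrans E1 (esym E2).
exists (supp h), (coef h); split=> [n nh|]; last exact: (torus_sum h).
have [l [lD ls lE]] := good_dual (good_along t' g0).
exists (fun i => absz (l i n)); rewrite {1}[n]lE; apply: eq_bigr => i _.
have : 0 <= l i n.
  (* Each coordinate of the exponents at t' gets its own extension; its values 0 and 1 on the basis
     at t' are nonnegative. *)
  apply: (reciprocity (lD := lD i) (Y := qtor K (extension (lD i))) _ _ iu v_def _ vh0 hh0 nh).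
  - by [].
  - exact: torus_domain ju.
  - by move=> j; rewrite /seed_at ls.
by move=> l0; rewrite -[in LHS](gez0_abs l0) -pmulrn.
Qed.
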